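(* Let $C, Z_O, Z_I$ be nonnegative integers with $Z_O + Z_I < C$, and consider secret and reliable communication over a network of capacity $C$ in the presence of an adversary with jamming rate $Z_O$ and eavesdropping rate $Z_I$. Then no rate higher than $C - Z_O - Z_I$ is achievable. Moreover, the rate $C - Z_O - Z_I$ is achievable with codes of computational complexity $O(n\,\mathrm{poly}(C,\log_2 q))$, where $n$ is the packet length and $q$ is the field size.
   Context: Network model. Let $q$ be a prime power, $C$ the network capacity (min-cut from source Alice to destination Bob), $Z_I$ the number of links eavesdropped by the adversary Calvin, and $Z_O$ the number of links jammed by Calvin. Alice has a message $S$ in a finite set $\mathcal{S}$ (uniformly distributed) and encodes it, using a possibly stochastic encoder, into a matrix $X \in \mathbb{F}_q^{C \times n}$, whose rows are packets of length $n$. The random coins of the encoder are unknown to both Bob and Calvin. Bob receives $Y = AX + Z \in \mathbb{F}_q^{C\times n}$, where $A \in \mathbb{F}_q^{C\times C}$ is a nonsingular matrix (the network transform, unknown to Bob) and $Z \in \mathbb{F}_q^{C \times n}$ is the error injected by Calvin, with $\mathrm{rank}(Z) \le Z_O$. Calvin observes $W = BX$ for some $B \in \mathbb{F}_q^{Z_I \times C}$ of his choice. Calvin is computationally unbounded and knows the encoding and decoding schemes, $A$, and $B$; he may choose $Z$ on the basis of these, of $W$, and of his own randomness, but he has no other access to $S$ or to Alice's random coins. Bob outputs an estimate $\hat S$ computed from $Y$. A scheme is perfectly secret if $I(S;W)=0$ for all $B \in \mathbb{F}_q^{Z_I\times C}$, where $I$ denotes mutual information. It has error probability less than $\epsilon$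 if $P[\hat S \ne S] < \epsilon$ for all nonsingular $A \in \mathbb{F}_q^{C\times C}$, all $B \in \mathbb{F}_q^{Z_I\times C}$, and all (possibly randomized) strategies by which Calvin chooses $Z \in \mathbb{F}_q^{C\times n}$ with $\mathrm{rank}(Z)\le Z_O$ as a function of the encoding and decoding schemes, $A$, $B$, $W$ and his own randomness. The rate of a scheme is $R = \frac{1}{n}\log_q|\mathcal{S}|$. A rate $R$ is achievable if for any $\epsilon>0$, any $\delta>0$, and all sufficiently large $n$, there exists a perfectly secret scheme of packet length (block length) $n$ with rate at least $R-\delta$ and error probability less than $\epsilon$. Here the field size $q$ is a design parameter that may be chosen depending on $n$. Computational complexity is the number of elementary operations needed for encoding and decoding. *)

(* Defs.v *)
From HB Require Import structures.
From mathcomp Require Import all_boot all_order all_algebra.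
From mathcomp Require Import reals exp.

Set Implicit Arguments.
Unset Strict Implicit.
Unset Printing Implicit Defensive.

Import Order.TTheory GRing.Theory Num.Theory.
Local Open Scope ring_scope.

Record fdist (R : realType) (T : finType) := FDist {
  pmf :> T -> R;
  pmf_ge0 : forall t, 0 <= pmf t;
  pmf_sum1 : \sum_t pmf t = 1 }.

(* Mutual information, in nats, of the joint law [p].  A pair of probability 0
   contributes 0 since [ln 0] is a real number. *)
Definition mutual_info (R : realType) (T U : finType) (p : T -> U -> R) : R :=
  \sum_t \sum_u
    p t u * ln (p t u / ((\sum_u' p t u') * (\sum_t' p t' u))).

Definition logb (R : realType) (b x : R) : R := ln x / ln b.

(* Alice sends X, Bob receives A *m X + Z, and the adversary Calvin observes
   B *m X and injects Z.  The message is uniform on [msg].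
   The stochastic encoder is a kernel: all that matters about Alice's coins is
   the law of the matrix X that they induce for each message. *)
Record scheme (R : realType) (F : finFieldType) (C n : nat) := Scheme {
  msg : finType;
  msg_gt0 : (0 < #|msg|)%N;
  enc : msg -> fdist R 'M[F]_(C, n);
  dec : 'M[F]_(C, n) -> msg }.

Section Scheme.
Variables (R : realType) (F : finFieldType) (C n : nat).
Variable sch : scheme R F C n.

Definition rate : R := logb #|F|%:R #|msg sch|%:R / n%:R.

Definition eavesdrop_law (ZI : nat) (B : 'M[F]_(ZI, C))
    (s : msg sch) (w : 'M[F]_(ZI, n)) : R :=
  #|msg sch|%:R^-1 * \sum_(X | B *m X == w) enc s X.

Definition perfectly_secret (ZI : nat) : Prop :=
  forall B : 'M[F]_(ZI, C), mutual_info (eavesdrop_law B) = 0.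

(* A randomized choice of Z given W; it is quantified after A, B and the
   scheme, hence may depend on them, but it sees X only through W. *)
Definition strategy (ZI : nat) := 'M[F]_(ZI, n) -> fdist R 'M[F]_(C, n).

Definition jams_at_most (ZO ZI : nat) (calvin : strategy ZI) : Prop :=
  forall w Z, calvin w Z != 0 -> (\rank Z <= ZO)%N.

Definition error_prob (ZI : nat) (A : 'M[F]_C) (B : 'M[F]_(ZI, C))
    (calvin : strategy ZI) : R :=
  \sum_(s : msg sch) #|msg sch|%:R^-1 *
    \sum_X enc s X *
      \sum_(Z | dec sch (A *m X + Z) != s) calvin (B *m X) Z.

Definition error_less_than (ZO ZI : nat) (eps : R) : Prop :=
  forall (A : 'M[F]_C) (B : 'M[F]_(ZI, C)) (calvin : strategy ZI),
    A \in unitmx -> jams_at_most ZO calvin -> error_prob A B calvin < eps.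

End Scheme.

(* Achievability of the rate [r] by schemes that moreover satisfy [Q]. *)
Definition achievable_with (R : realType) (C ZO ZI : nat)
    (Q : forall (F : finFieldType) (n : nat), scheme R F C n -> Prop)
    (r : R) : Prop :=
  forall eps delta : R, 0 < eps -> 0 < delta ->
  exists N : nat, forall n : nat, (N <= n)%N ->
  exists (F : finFieldType) (sch : scheme R F C n),
    [/\ perfectly_secret sch ZI, r - delta <= rate sch,
        error_less_than sch ZO ZI eps & Q F n sch].

Definition achievable (R : realType) (C ZO ZI : nat) (r : R) : Prop :=
  achievable_with ZO ZI (fun F n (_ : scheme R F C n) => True) r.

(* The elementary operations are bit operations.  A program is a straight-line
   list of binary Boolean gates (a Boolean circuit): the wires are the input
   bits followed by the results of the gates in order, and out-of-range wires
   carry [false].  There is deliberately no branching: the depth of a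
   non-uniform decision tree would make every function of N bits cost N. *)
Record gate := Gate {
  gate_op : bool -> bool -> bool;
  gate_left : nat;
  gate_right : nat }.

Record circuit := Circuit { gates : seq gate; outputs : seq nat }.

Definition run_gate (wires : seq bool) (g : gate) : seq bool :=
  rcons wires (gate_op g (nth false wires (gate_left g))
                         (nth false wires (gate_right g))).

Definition run (c : circuit) (input : seq bool) : seq bool :=
  let wires := foldl run_gate input (gates c) in
  [seq nth false wires i | i <- outputs c].

Definition mx_bits (F : finFieldType) (l : nat) (code : F -> l.-tuple bool)
    (C n : nat) (X : 'M[F]_(C, n)) : seq bool :=
  flatten [seq tval (code (X i j)) | i <- enum 'I_C, j <- enum 'I_n].

(* The encoder runs on the message and [k] fair coin tosses, each of which
   costs one operation.  Hence it can only induce dyadic probabilities, which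
   in practice calls for fields of characteristic 2.  Symbols and messages are represented on the least
   possible number of bits, as redundant representations could hide
   computation. *)
Definition complexity_at_most (R : realType) (F : finFieldType) (C n : nat)
    (sch : scheme R F C n) (T : R) : Prop :=
  exists (fcode : F -> (up_log 2 #|F|).-tuple bool)
         (mcode : msg sch -> (up_log 2 #|msg sch|).-tuple bool)
         (k : nat) (cenc cdec : circuit),
    [/\ injective fcode /\ injective mcode,
        forall (s : msg sch) (X : 'M[F]_(C, n)),
          enc s X =
            #|[set c : k.-tuple bool |
                 run cenc (mcode s ++ c) == mx_bits fcode X]|%:R / 2 ^+ k,
        forall Y : 'M[F]_(C, n),
          run cdec (mx_bits fcode Y) = mcode (dec sch Y)
      & (size (gates cenc) + k + size (gates cdec))%:R <= T].

(* Main.v *)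
Require Import Defs.
From HB Require Import structures.
From mathcomp Require Import all_boot all_order all_algebra.
From mathcomp Require Import all_fingroup all_solvable all_field.
From mathcomp Require Import reals exp.
From mathcomp Require Import ring lra.

(* Converse.  Calvin taps Z_I rows and adds uniform noise to Z_O others.  By
   secrecy the tapped rows are independent of the message, so Bob has to recover
   it from the remaining C - Z_O - Z_I rows and succeeds with probability at most
   q^(n (C - Z_O - Z_I)) / |S|.

   Achievability.  Let F = GF(2^m) be the network field, with m a small constant
   times n, and L its extension of degree C; packets are read as vectors over L.
   Every column sent is T2 *m V + payload, where T2 is a Moore matrix and V is
   uniform: B *m T2 is invertible for every B over F of full rank, hence
   observing B *m X reveals only V-masked data and the code is perfectly secret.
   The message rows S travel as T3 *m S, with [T2 | T3] again a Moore matrix, so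
   that some L-combination of the rows received equals any given row of S
   whatever Z is.  Bob finds it by a polynomial hash of S at a random point rho.
   The pair (rho, hash) is sent bit by bit: a bit 0 is sent as T2 *m V and a bit
   1 as a uniform matrix.  If the bit is 0, then some vector of the left kernel
   over L of the matrix received has entries of F-rank greater than Z_I (here
   Z_O + Z_I < C is used); if it is 1, then with high probability this kernel is
   contained in the span of the rows of B A^-1, of which there are only Z_I.
   All computations are linear algebra over GF(2) and multiplications in L, hence
   of cost polynomial in n and m; since n <= m^2, the cost is at most n m^90. *)

(** Unique decoding against errors of rank Z_O would cost 2 Z_O rows instead of Z_O. To lose only
    Z_O, Bob needs a random hash key that is hidden from Calvin while he chooses Z and that
    nevertheless survives his jamming. Single bits can be sent this way: Z_O dimensions cannot fill
    the room that a bit 0 leaves free, and Calvin cannot cancel a random matrix that he does not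
    see.

    Failures are counted after a change of variables: for a fixed message, key and family of random
    matrices, the masks [w.1] are in bijection with the values [V] that determine Calvin's view.
    Hence [V] and Z can be fixed first, and the message, the key and the matrices are still uniform.

    Each failure event is a union over the |L|^C row vectors over L. The random matrices have C + 1
    columns and the hash has C + 1 points so that a single vector fails with probability about
    |L|^-(C+1). With m proportional to n, |L| is exponential in n, while the key takes kap m symbols
    of a packet, a fraction of n as small as desired when n / m is large. *)

Set Implicit Arguments.
Unset Strict Implicit.
Unset Printing Implicit Defensive.

Import Order.TTheory GRing.Theory Num.Theory.

(** * Straight-line programs *)

Section Wires.

Variables (D : Type) (inp : D -> seq bool) (n0 : nat).
Hypothesis size_inp : forall d, size (inp d) = n0.

(** The inputs are indexed by abstract data [D], encoded by [inp], so that a wire is specified by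
    what it means and not as a function of bit strings. *)
Definition has_wire (gs : seq gate) (f : D -> bool) :=
  exists2 i, i < n0 + size gs &
    forall d, nth false (foldl run_gate (inp d) gs) i = f d.

Lemma size_wires gs d : size (foldl run_gate (inp d) gs) = n0 + size gs.
Proof.
elim/last_ind: gs => [|gs g IH]; first by rewrite addn0 /= size_inp.
by rewrite -cats1 foldl_cat /= size_rcons IH size_cat addn1 addnS.
Qed.

Lemma has_wire_rcons gs g f : has_wire gs f -> has_wire (rcons gs g) f.
Proof.
case=> i lt_i Hi; exists i => [|d].
  by rewrite size_rcons addnS ltnS ltnW.
by rewrite -cats1 foldl_cat /= nth_rcons size_wires lt_i.
Qed.

Lemma has_wire_cat gs gs' f : has_wire gs f -> has_wire (gs ++ gs') f.
Proof.
elim/last_ind: gs' => [|gs' g IH] gsf; first by rewrite cats0.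
by rewrite -rcons_cat; apply/has_wire_rcons/IH.
Qed.

Lemma has_wire_gate op gs f g :
  has_wire gs f -> has_wire gs g ->
  exists x, has_wire (rcons gs x) (fun d => op (f d) (g d)).
Proof.
case=> i lt_i Hi [j lt_j Hj]; exists (Gate op i j).
exists (n0 + size gs) => [|d]; first by rewrite size_rcons addnS.
by rewrite -cats1 foldl_cat /= nth_rcons size_wires ltnn eqxx Hi Hj.
Qed.

Lemma eq_has_wire gs f g : f =1 g -> has_wire gs f -> has_wire gs g.
Proof. by move=> eq_fg [i lt_i Hi]; exists i => // d; rewrite Hi. Qed.

Definition extends (gs gs' : seq gate) := exists hs, gs' = gs ++ hs.

Lemma extends_refl gs : extends gs gs.
Proof. by exists [::]; rewrite cats0. Qed.

Lemma extends_trans gs1 gs2 gs3 :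
  extends gs1 gs2 -> extends gs2 gs3 -> extends gs1 gs3.
Proof. by move=> [h1 ->] [h2 ->]; exists (h1 ++ h2); rewrite catA. Qed.

Definition mono (Q : seq gate -> Prop) :=
  forall gs gs', extends gs gs' -> Q gs -> Q gs'.

Lemma mono_has f : mono (has_wire^~ f).
Proof. by move=> gs _ [hs ->]; apply: has_wire_cat. Qed.

Lemma mono_all (I : Type) (Q : I -> seq gate -> Prop) :
  (forall i, mono (Q i)) -> mono (fun gs => forall i, Q i gs).
Proof. by move=> mQ gs gs' ext Hgs i; apply: mQ ext (Hgs i). Qed.

(** Programs only grow and the properties of interest are [mono], so values computed once remain
    available to all later steps. *)
Definition can t gs (Q : seq gate -> Prop) :=
  exists gs', [/\ extends gs gs', size gs' <= size gs + t & Q gs'].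

Lemma can_ret gs (Q : seq gate -> Prop) : Q gs -> can 0 gs Q.
Proof. by exists gs; rewrite addn0; split=> //; apply: extends_refl. Qed.

Lemma can_le t t' gs Q : t <= t' -> can t gs Q -> can t' gs Q.
Proof.
move=> le_tt' [gs' [ext sz Hgs']]; exists gs'; split=> //.
by apply: leq_trans sz _; rewrite leq_add2l.
Qed.

Lemma can_imp t gs (Q Q' : seq gate -> Prop) :
  (forall gs', Q gs' -> Q' gs') -> can t gs Q -> can t gs Q'.
Proof. by move=> QQ' [gs' [ext sz /QQ' Hgs']]; exists gs'. Qed.

Lemma can_bind t u gs (Q Q' : seq gate -> Prop) :
  can t gs Q -> (forall gs', extends gs gs' -> Q gs' -> can u gs' Q') ->
  can (t + u) gs Q'.
Proof.
move=> [gs1 [ext1 sz1 H1]] /(_ gs1 ext1 H1) [gs2 [ext2 sz2 H2]].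
exists gs2; split=> //; first exact: extends_trans ext1 ext2.
by rewrite addnA; apply: leq_trans sz2 _; rewrite leq_add2r.
Qed.

Lemma can_iter t k gs (Q : nat -> seq gate -> Prop) :
  Q 0 gs ->
  (forall j gs', j < k -> extends gs gs' -> Q j gs' -> can t gs' (Q j.+1)) ->
  can (k * t) gs (Q k).
Proof.
move=> Q0; elim: k => [|k IH] Qs; first exact: can_ret.
rewrite mulSn addnC; apply: can_bind (IH _) _ => [j gs' ltj|gs' ext Qk].
  by apply: Qs; rewrite ltnS ltnW.
exact: Qs.
Qed.

Lemma can_all_seq (I : eqType) t gs (s : seq I) (Q : I -> seq gate -> Prop) :
  (forall i, mono (Q i)) ->
  (forall i gs', extends gs gs' -> can t gs' (Q i)) ->
  can (size s * t) gs (fun gs' => forall i, i \in s -> Q i gs').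
Proof.
move=> mQ Qs; elim: s => [|i s IH] /=; first exact: can_ret.
rewrite mulSn addnC; apply: can_bind IH _ => gs1 ext1 H1.
have [gs2 [ext2 sz2 H2]] := Qs i gs1 ext1.
exists gs2; split=> // j; rewrite inE => /predU1P[-> // | /H1].
exact: mQ.
Qed.

Lemma can_all (I : finType) t gs (Q : I -> seq gate -> Prop) :
  (forall i, mono (Q i)) ->
  (forall i gs', extends gs gs' -> can t gs' (Q i)) ->
  can (#|I| * t) gs (fun gs' => forall i, Q i gs').
Proof.
move=> mQ Qs; rewrite cardE.
apply: can_imp (can_all_seq _ mQ Qs) => gs' H i.
by apply: H; rewrite mem_enum.
Qed.

Lemma can_op op gs f g :
  has_wire gs f -> has_wire gs g ->
  can 1 gs (has_wire^~ (fun d => op (f d) (g d))).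
Proof.
move=> gsf gsg; have [x Hx] := has_wire_gate op gsf gsg.
exists (rcons gs x); split=> //; last by rewrite size_rcons addn1.
by exists [:: x]; rewrite cats1.
Qed.

Lemma can_const b gs : can 1 gs (has_wire^~ (fun=> b)).
Proof.
exists (rcons gs (Gate (fun _ _ => b) 0 0)).
split; [by exists [:: Gate (fun _ _ => b) 0 0]; rewrite cats1 | by rewrite size_rcons addn1 |].
exists (n0 + size gs) => [|d]; first by rewrite size_rcons addnS.
by rewrite -cats1 foldl_cat /= nth_rcons size_wires ltnn eqxx.
Qed.

Lemma can_mux gs c f g :
  has_wire gs c -> has_wire gs f -> has_wire gs g ->
  can 3 gs (has_wire^~ (fun d => if c d then f d else g d)).
Proof.
move=> gsc gsf gsg.
apply: (can_bind (t := 1) (u := 2)); first exact: (can_op andb gsc gsf).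
move=> gs1 ext1 H1; apply: (can_bind (t := 1) (u := 1)).
  exact: (can_op (fun a b => ~~ a && b) (mono_has ext1 gsc) (mono_has ext1 gsg)).
move=> gs2 ext2 H2; have := can_op orb (mono_has ext2 H1) H2.
by apply: can_imp => gs3; apply: eq_has_wire => d; case: (c d); rewrite ?orbF.
Qed.

(** Shannon expansion on the first argument. The cost is exponential, which is harmless for a number
    of arguments independent of n. *)
Lemma can_fun (K : Type) gs (ks : seq K) (f : K -> D -> bool)
    (g : seq bool -> bool) :
  (forall k, has_wire gs (f k)) ->
  can (4 * 2 ^ size ks) gs (has_wire^~ (fun d => g [seq f k d | k <- ks])).
Proof.
(* The exact cost solves T(k+1) = 2 T(k) + 3 with T(0) = 1, since a multiplexer takes 3 gates. *)
move=> gsf; suffices: can (4 * 2 ^ size ks - 3) gs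
    (has_wire^~ (fun d => g [seq f k d | k <- ks])).
  exact/can_le/leq_subr.
elim: ks gs g gsf => [|k ks IH] gs g gsf /=; first exact: can_const.
have le3: 3 <= 4 * 2 ^ size ks.
  by apply: (@leq_trans 4) => //; rewrite leq_pmulr // expn_gt0.
have ->: 4 * 2 ^ (size ks).+1 - 3
      = (4 * 2 ^ size ks - 3) + ((4 * 2 ^ size ks - 3) + 3).
  by rewrite subnK // addnBAC // expnS mulnCA mul2n addnn.
apply: can_bind (IH gs (fun s => g (true :: s)) gsf) _ => gs1 ext1 H1.
apply: can_bind (IH gs1 (fun s => g (false :: s)) _) _ => [h|gs2 ext2 H2].
  exact: mono_has ext1 (gsf h).
have gsk := mono_has (extends_trans ext1 ext2) (gsf k).
have := can_mux gsk (mono_has ext2 H1) H2.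
by apply: can_imp => gs3; apply: eq_has_wire => d; case: (f k d).
Qed.

Lemma can_big op idx (I : Type) (s : seq I) gs (f : I -> D -> bool) :
  (forall i, has_wire gs (f i)) ->
  can (size s).+1 gs (has_wire^~ (fun d => \big[op/idx]_(i <- s) f i d)).
Proof.
move=> gsf; elim: s => [|i s IH].
  apply: can_imp (can_const idx gs) => gs'; apply: eq_has_wire => d.
  by rewrite big_nil.
rewrite -addn1; apply: can_bind IH _ => gs1 ext1 H1.
have := can_op op (mono_has ext1 (gsf i)) H1.
by apply: can_imp => gs2; apply: eq_has_wire => d; rewrite big_cons.
Qed.

Lemma wires_circuit gs (K : Type) (ks : seq K) (f : K -> D -> bool) :
  (forall k, has_wire gs (f k)) ->
  exists c, gates c = gs /\ forall d, run c (inp d) = [seq f k d | k <- ks].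
Proof.
move=> gsf; suffices [os Hos]: exists os, forall d,
    [seq nth false (foldl run_gate (inp d) gs) i | i <- os] =
    [seq f k d | k <- ks].
  by exists (Circuit gs os).
elim: ks => [|k ks [os Hos]]; first by exists [::].
by have [i _ Hi] := gsf k; exists (i :: os) => d /=; rewrite Hi Hos.
Qed.

Lemma input_wire (K : eqType) (ks : seq K) (f : K -> D -> bool) k :
  size ks = n0 -> (forall d, inp d = [seq f k d | k <- ks]) -> k \in ks ->
  has_wire [::] (f k).
Proof.
move=> szk inpE ks_k; have lt_k: index k ks < size ks by rewrite index_mem.
exists (index k ks) => [|d] /=; first by rewrite addn0 -szk.
by rewrite inpE (nth_map k) // nth_index.
Qed.

End Wires.

Lemma map_nth_index (K : finType) (c : seq bool) : size c = #|K| ->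
  [seq nth false c (index x (enum K)) | x <- enum K] = c.
Proof.
move=> szc; have sz : size [seq nth false c (index x (enum K)) | x <- enum K] = size c.
  by rewrite size_map -cardE szc.
apply: (@eq_from_nth _ false) => // i; rewrite sz szc cardE => lt_i.
have x0 : K by case: (enum K) lt_i.
by rewrite (nth_map x0) // index_uniq // enum_uniq.
Qed.

(** * Choice of the parameters *)

(** [kap * m] is the room taken by the key in a packet: (R+1)(C+1) elements of L, each of C m bits,
    every bit on C+1 slots of C symbols. The remaining [l] slots carry the message. The excess of
    [m] over 2 K yields n < 2 K m <= m^2. *)
Lemma code_parameters (C R K m0 n : nat) :
  let kap := R.+1 * C.+1 * C * C.+1 * C in
  let m := n %/ K in
  let s := R.+1 * C.+1 * (C * m) in
  let l := n %/ C - s * C.+1 in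
  0 < C -> 0 < K -> kap <= K -> K * (m0 + 2 * K).+1 <= n ->
  [/\ [/\ m0 <= m, 0 < m, n < 2 * K * m & n <= m ^ 2],
      m * K <= n, (l + s * C.+1) * C <= n & n <= l * C + C + kap * m].
Proof.
move=> kap m s l C_gt0 K_gt0 kap_K le_n.
have m_ge : m0 + 2 * K < m by rewrite /m leq_divRL // mulnC.
have m_gt0 : 0 < m by apply: leq_ltn_trans m_ge.
have mK : m * K <= n by apply: leq_trunc_div.
have n_lt : n < 2 * K * m.
  apply: leq_trans (ltn_ceil n K_gt0) _; rewrite -/m mulnC -mulnA mulnCA leq_mul2l.
  apply/orP; right; rewrite mul2n -addnn -addn1 leq_add2l //.
have sE : s * C.+1 * C = kap * m by rewrite /s /kap; ring.
have s_le : s * C.+1 <= n %/ C.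
  by rewrite leq_divRL // sE; apply: leq_trans mK; rewrite mulnC leq_mul2l kap_K orbT.
split=> //; first split=> //.
- by apply: leq_trans (ltnW m_ge); apply: leq_addr.
- rewrite ltnW // (leq_trans n_lt) // expnS expn1 leq_mul2r; apply/orP; right.
  by apply: leq_trans (ltnW m_ge); apply: leq_addl.
- by rewrite subnK // leq_trunc_div.
- rewrite /l mulnBl -sE -addnA [C + _]addnC addnA subnK; last by rewrite leq_mul2r s_le orbT.
  by rewrite addnC -mulSn ltnW // ltn_ceil.
Qed.

(** The sets over which the circuits loop have at most n^3 elements, so n^3 can be the base in which
    circuit sizes are measured. The last bound is on the number of coin tosses. *)
Lemma complexity_parameters (C R ZI l m n : nat) :
  let s := R.+1 * C.+1 * (C * m) in
  let kap := R.+1 * C.+1 * C * C.+1 * C in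
  0 < C -> ZI <= C -> 3 <= n -> C < n -> 4 * 2 ^ C <= n ->
  kap * m <= n -> (l + s * C.+1) * C <= n ->
  [/\ [/\ 4 <= n ^ 3, C * m * (C * m) <= n ^ 3, l <= n ^ 3 & C.+1 <= n ^ 3],
      [/\ l + s * C.+1 <= n ^ 3, C.+1 * (C * m) + l * (C * m) <= n ^ 3,
          C.+1 * (C * m) + C * m <= n ^ 3 & 4 * 2 ^ C <= n ^ 3],
      s <= n, l <= n &
      ((l + s * C.+1) * ZI + (C.+1 + s * (C * C.+1))) * (C * m) <= n ^ 3].
Proof.
move=> s kap C_gt0 ZI_le n_ge3 n_C n_exp kapm slots.
have le_cube a : a <= n -> a <= n ^ 3.
  by move=> /leq_trans; apply; rewrite -[X in X <= _]expn1 leq_pexp2l // ltnW // ltnW.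
have le_mul2 a b : a <= n -> b <= n -> a * b <= n ^ 2.
  by move=> le_a le_b; rewrite expnS expn1 leq_mul.
have le_3sq a b c : a <= n ^ 2 -> b <= n ^ 2 -> c <= n ^ 2 -> a + b + c <= n ^ 3.
  move=> le_a le_b le_c; apply: (@leq_trans (3 * n ^ 2)).
    by rewrite !mulSn mul0n addn0 addnA !leq_add.
  by rewrite [X in _ <= X]expnS leq_mul2r n_ge3 orbT.
have le_sq a : a <= n -> a <= n ^ 2.
  by move=> /leq_trans; apply; rewrite expnS expn1 leq_pmulr // ltnW // ltnW.
have slot_le : l + s * C.+1 <= n by apply: leq_trans slots; rewrite leq_pmulr.
have l_le : l <= n by apply: leq_trans slot_le; apply: leq_addr.
have s_le : s <= n.
  by apply: leq_trans slot_le; apply: leq_trans (leq_addl _ _); rewrite leq_pmulr.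
have sE : s * C.+1 * C = kap * m by rewrite /s /kap; ring.
have Cm_le : C.+1 * (C * m) <= n.
  apply: leq_trans kapm.
  have -> : kap * m = C.+1 * (C * m) * (R.+1 * C.+1 * C) by rewrite /kap; ring.
  by rewrite leq_pmulr // !muln_gt0 C_gt0.
have Cm_le' : C * m <= n by apply: leq_trans Cm_le; rewrite leq_pmull.
split; [split | split | exact: s_le | exact: l_le |].
- by apply: (@leq_trans (3 ^ 3)) => //; rewrite leq_exp2r.
- have := le_3sq _ 0 0 (le_mul2 _ _ Cm_le' Cm_le') isT isT; rewrite !addn0; exact.
- exact: le_cube.
- exact: le_cube.
- exact: le_cube.
- have := le_3sq _ _ 0 (le_sq _ Cm_le) (le_mul2 _ _ l_le Cm_le') isT; rewrite addn0; exact.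
- have := le_3sq _ _ 0 (le_sq _ Cm_le) (le_sq _ Cm_le') isT; rewrite addn0; exact.
- exact: le_cube.
- rewrite mulnDl [X in _ + X]mulnDl addnA; apply: le_3sq; apply: le_mul2 => //.
    by apply: leq_trans slots; rewrite leq_mul2l ZI_le orbT.
  by rewrite [C * C.+1]mulnC mulnA sE.
Qed.

(** 13 and 15 are the exponents of the encoder and of the decoder over the base n^3, and [k] counts
    the tosses. From (n^3)^15 = n^45 and n <= m^2 comes m^90; the spare factor n absorbs the three
    summands. *)
Lemma circuit_size_bound (n m k : nat) : 3 <= n -> k <= n ^ 3 -> n <= m ^ 2 ->
  (n ^ 3) ^ 13 + k + (n ^ 3) ^ 15 <= n * m ^ 90.
Proof.
move=> n_ge3 le_k n_m2; have n_gt0 : 0 < n by apply: ltn_trans n_ge3.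
apply: (@leq_trans (n * n ^ 45)); last first.
  by rewrite leq_mul2l (_ : 90 = 2 * 45) // expnM leq_exp2r ?n_m2 ?orbT.
apply: (@leq_trans (3 * n ^ 45)); last by rewrite leq_mul2r n_ge3 orbT.
rewrite -!expnM !mulSnr mul0n add0n; apply: leq_add; [apply: leq_add |] => //.
  by rewrite leq_pexp2l.
by apply: leq_trans le_k _; rewrite leq_pexp2l.
Qed.

Local Open Scope ring_scope.

(** * Gaussian elimination over the field with two elements *)

Section Elimination.

Variables (I : finType) (ps : seq I).
Local Notation V := {ffun I -> bool}.

(** The entry of [t] at the first pivot of [y], or [false] if [y] has none. That position depends on
    the data; the fold selects it with multiplexers, as circuits cannot branch. *)
Definition coef (y t : V) : bool :=
  foldr (fun a acc => if y a then t a else acc) false ps.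

Definition clear (y t : V) : V := if coef y t then t + y else t.

Fixpoint red_rec n (rows : seq V) (t : V) : V :=
  if n is n'.+1 then
    if rows is y :: rest then red_rec n' [seq clear y r | r <- rest] (clear y t)
    else t
  else t.

Definition red rows := red_rec (size rows) rows.

Lemma red_cons y rows t :
  red (y :: rows) t = red [seq clear y r | r <- rows] (clear y t).
Proof. by rewrite /red size_map. Qed.

Lemma coefD y : {morph coef y : t u / t + u}.
Proof.
move=> t u; rewrite /coef; elim: ps => [|a s IH] //=.
by rewrite IH ffunE; case: (y a).
Qed.

Lemma clearD y : {morph clear y : t u / t + u}.
Proof.
move=> t u; rewrite /clear coefD; case: (coef y t); case: (coef y u) => /=.
- rewrite addrACA; apply/ffunP => i; rewrite !ffunE.
  by case: (t i) (u i) (y i) => [] [] [].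
- by rewrite addrAC.
- by rewrite addrA.
- by [].
Qed.

Lemma coef_vanish y (t : V) : (forall a, a \in ps -> t a = false) -> coef y t = false.
Proof.
rewrite /coef; elim: ps => //= a s IH t0; case: (y a).
  by rewrite t0 ?mem_head.
by apply: IH => b sb; apply: t0; rewrite inE sb orbT.
Qed.

Lemma clear_self (y : V) a : a \in ps -> clear y y a = false.
Proof.
move=> ps_a; rewrite /clear; have [yy | ny] := boolP (coef y y).
  by rewrite ffunE; case: (y a).
apply: contraNF ny; rewrite /coef; elim: ps ps_a => //= b s IH.
rewrite inE => /predU1P[<- -> // | sa ya].
by rewrite IH //; case: (y b).
Qed.

(** Membership in the span over GF(2) of [K] and the rows: there, closure under addition is all that
    a subspace requires. *)
Definition gen (K : V -> Prop) (rows : seq V) (t : V) :=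
  forall G : V -> Prop, G 0 -> (forall u v, G u -> G v -> G (u + v)) ->
    (forall v, K v -> G v) -> (forall y, y \in rows -> G y) -> G t.

(** [clear y] is additive, kills [y] on the pivots and fixes the vectors that vanish there. It thus
    sends a combination of [y], the other rows and such vectors to a combination of the cleared rows
    and such vectors, and the induction needs no record of the pivots already used. *)
Lemma red_eq0 rows t :
  gen (fun v => forall a, a \in ps -> v a = false) rows t ->
  forall a, a \in ps -> red rows t a = false.
Proof.
elim: {rows}(size rows) {-2}rows (erefl (size rows)) t => [|n IH] [|y rows] //.
  move=> _ t /(_ (fun v => forall a, a \in ps -> v a = false)); apply=> //.
    by move=> a _; rewrite ffunE.
  by move=> u v u0 v0 a ps_a; rewrite ffunE u0 // v0.
move=> [szr] t gen_t; rewrite red_cons; apply: IH; first by rewrite size_map.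
move=> G G0 GD GK Grows; apply: (gen_t (fun v => G (clear y v))).
- by rewrite /clear coef_vanish => [|a _]; rewrite ?ffunE.
- by move=> u v Gu Gv; rewrite clearD; apply: GD.
- by move=> v v0; rewrite /clear coef_vanish //; apply: GK.
- move=> z; rewrite inE => /predU1P[-> | rows_z].
    by apply: GK => a; apply: clear_self.
  by apply: Grows; apply: map_f.
Qed.

Lemma red_sub (G : V -> Prop) rows t :
  G 0 -> (forall u v, G u -> G v -> G (u + v)) -> (forall y, y \in rows -> G y) ->
  exists2 g, G g & red rows t = t + g.
Proof.
move=> G0 GD; elim: {rows}(size rows) {-2}rows (erefl (size rows)) t =>
  [|n IH] [|y rows] //; first by move=> _ t _; exists 0; rewrite ?addr0.
move=> [szr] t Grows; have Gy: G y by apply: Grows; apply: mem_head.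
rewrite red_cons; have [|z|g Gg ->] := IH [seq clear y r | r <- rows] _ (clear y t).
- by rewrite size_map.
- case/mapP=> r rows_r ->; have Gr: G r.
    by apply: Grows; rewrite inE rows_r orbT.
  by rewrite /clear; case: ifP => // _; apply: GD.
- rewrite /clear; case: ifP => _; last by exists g.
  by exists (y + g); [apply: GD | rewrite addrA].
Qed.

End Elimination.

(** * Circuit sizes measured by the exponent of a base *)

Section Bounded.

Variables (D : Type) (inp : D -> seq bool) (n0 : nat).
Hypothesis size_inp : forall d, size (inp d) = n0.
Variable B : nat.
Hypothesis B_ge4 : (4 <= B)%N.

Local Notation has_wire := (has_wire inp n0).

(** Exact gate counts are given up: a loop over at most [B] indices adds 1 to the exponent, and so
    does sequencing, because 2 B^e <= B^(e+1). *)
Definition feasible e gs Q := can (B ^ e) gs Q.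

Let B_gt0 : (0 < B)%N. Proof. exact: leq_trans B_ge4. Qed.

Lemma feasible_le e e' gs Q :
  (e <= e')%N -> feasible e gs Q -> feasible e' gs Q.
Proof. by move=> le_ee'; apply: can_le; rewrite leq_pexp2l. Qed.

Lemma feasible_imp e gs (Q Q' : seq gate -> Prop) :
  (forall gs', Q gs' -> Q' gs') -> feasible e gs Q -> feasible e gs Q'.
Proof. exact: can_imp. Qed.

Lemma feasible_ret e gs (Q : seq gate -> Prop) : Q gs -> feasible e gs Q.
Proof. by move=> Qgs; apply: can_le (can_ret Qgs). Qed.

Lemma feasible_bind e e' gs (Q Q' : seq gate -> Prop) :
  feasible e gs Q ->
  (forall gs', extends gs gs' -> Q gs' -> feasible e' gs' Q') ->
  feasible (maxn e e').+1 gs Q'.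
Proof.
move=> H1 H2; apply: can_le (can_bind H1 H2).
rewrite expnS; apply: (@leq_trans (2 * B ^ maxn e e')).
  by rewrite mul2n -addnn leq_add ?leq_pexp2l ?leq_maxl ?leq_maxr.
by rewrite leq_mul2r (leq_trans _ B_ge4) ?orbT.
Qed.

Lemma feasible_all (I : finType) e gs (Q : I -> seq gate -> Prop) :
  (#|I| <= B)%N -> (forall i, mono (Q i)) ->
  (forall i gs', extends gs gs' -> feasible e gs' (Q i)) ->
  feasible e.+1 gs (fun gs' => forall i, Q i gs').
Proof.
move=> leIB mQ /(can_all mQ); apply: can_le.
by rewrite expnS leq_mul2r leIB orbT.
Qed.

Lemma feasible_iter e k gs (Q : nat -> seq gate -> Prop) :
  (k <= B)%N -> Q 0 gs ->
  (forall j gs', (j < k)%N -> extends gs gs' -> Q j gs' ->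
     feasible e gs' (Q j.+1)) ->
  feasible e.+1 gs (Q k).
Proof.
move=> lekB Q0 /(can_iter Q0); apply: can_le.
by rewrite expnS leq_mul2r lekB orbT.
Qed.

Lemma feasible_op op gs f g :
  has_wire gs f -> has_wire gs g ->
  feasible 0 gs (has_wire^~ (fun d => op (f d) (g d))).
Proof. exact: can_op. Qed.

Lemma feasible_const b gs : feasible 0 gs (has_wire^~ (fun=> b)).
Proof. exact: can_const. Qed.

Lemma feasible_big op idx (I : finType) gs (f : I -> D -> bool) :
  (#|I| <= B)%N -> (forall i, has_wire gs (f i)) ->
  feasible 2 gs (has_wire^~ (fun d => \big[op/idx]_i f i d)).
Proof.
move=> leIB gsf; apply: can_le (can_big size_inp op idx (index_enum I) gsf).
have ->: size (index_enum I) = #|I|.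
  by rewrite cardT; apply: perm_size; apply: uniq_perm;
     rewrite ?index_enum_uniq ?enum_uniq // => i; rewrite mem_index_enum mem_enum.
apply: (@leq_trans (B + B)); first by rewrite -addn1 leq_add.
by rewrite addnn -mul2n expnS expn1 leq_mul2r (leq_trans _ B_ge4) ?orbT.
Qed.

Definition vec_wires (I : finType) gs (v : D -> {ffun I -> bool}) :=
  forall i, has_wire gs (fun d => v d i).

Lemma mono_vec (I : finType) (v : D -> {ffun I -> bool}) :
  mono (fun gs => vec_wires gs v).
Proof. by apply: mono_all => i; apply: mono_has. Qed.

Lemma eq_vec_wires (I : finType) gs (v w : D -> {ffun I -> bool}) :
  v =1 w -> vec_wires gs v -> vec_wires gs w.
Proof. by move=> eq_vw gsv i; apply: eq_has_wire (gsv i) => d; rewrite eq_vw. Qed.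

Variables (I : finType) (ps : seq I).
Hypotheses (leIB : (#|I| <= B)%N) (lepsB : (size ps <= B)%N).

Lemma feasible_coef gs (y t : D -> {ffun I -> bool}) :
  vec_wires gs y -> vec_wires gs t ->
  feasible 2 gs (has_wire^~ (fun d => coef ps (y d) (t d))).
Proof.
move=> gsy gst; apply: (@can_le (size ps * 3 + 1)).
  apply: (@leq_trans (B * 3 + B)); first by rewrite leq_add ?leq_mul2r ?lepsB.
  by rewrite -mulnSr expnS expn1 leq_mul2l B_ge4 orbT.
rewrite addnC /coef; elim: ps => [|a s IH] /=; first exact: can_const.
rewrite mulSn addnCA addnC; apply: can_bind IH _ => gs1 ext1 H1.
exact: (can_mux size_inp (mono_has size_inp ext1 (gsy a))
                (mono_has size_inp ext1 (gst a)) H1).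
Qed.

Lemma feasible_clear gs (y t : D -> {ffun I -> bool}) :
  vec_wires gs y -> vec_wires gs t ->
  feasible 3 gs (fun gs' => vec_wires gs' (fun d => clear ps (y d) (t d))).
Proof.
move=> gsy gst; apply: (feasible_bind (e' := 2) (feasible_coef gsy gst)).
move=> gs1 ext1 H1; apply: feasible_all => // [i|i gs2 ext2].
  exact: mono_has.
have ext12 := extends_trans ext1 ext2.
apply: (@feasible_bind 0 0) (feasible_op andb (mono_has size_inp ext2 H1)
  (mono_has size_inp ext12 (gsy i))) _ => gs3 ext3 H3.
have := feasible_op addb (mono_has size_inp (extends_trans ext12 ext3) (gst i)) H3.
apply: feasible_imp => gs4; apply: eq_has_wire => d; rewrite /clear.
by case: (coef _ _ _) => /=; rewrite ?addbF // ffunE.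
Qed.

Lemma feasible_red (K : finType) (ks : seq K) gs
    (row : K -> D -> {ffun I -> bool}) (t : D -> {ffun I -> bool}) :
  (#|K| <= B)%N -> (size ks <= B)%N ->
  (forall k, vec_wires gs (row k)) -> vec_wires gs t ->
  feasible 6 gs
    (fun gs' => vec_wires gs' (fun d => red ps [seq row k d | k <- ks] (t d))).
Proof.
move=> leKB leksB gsr gst; apply: (@can_le (size ks * B ^ 5)).
  (* A round clears all the rows and [t] by the current first row, for at most B^5 gates. *)
  by rewrite (expnS _ 5) leq_mul2r leksB orbT.
elim: ks {leksB} gs row t gsr gst => [|k ks IH] gs row t gsr gst /=.
  exact: can_ret.
rewrite mulSn; apply: (@can_bind (B ^ 5) _ gs (fun gs' =>
   (forall j, vec_wires gs' (fun d => clear ps (row k d) (row j d))) /\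
   vec_wires gs' (fun d => clear ps (row k d) (t d)))).
  apply: (@feasible_bind 4 3) => [|gs1 ext1 H1].
    apply: (@feasible_all K 3 gs (fun j gs' =>
      vec_wires gs' (fun d => clear ps (row k d) (row j d)))) => // [j|j gs1 ext1].
      exact: mono_vec.
    by apply: feasible_clear; apply: mono_vec ext1 _.
  have gs1t := feasible_clear (mono_vec ext1 (gsr k)) (mono_vec ext1 gst).
  have [gs2 [ext2 sz2 H2]] := gs1t.
  by exists gs2; split=> //; split=> // j; apply: mono_vec ext2 _.
move=> gs1 ext1 [Hr Ht]; have := IH gs1 _ _ Hr Ht.
apply: can_imp => gs2; apply: eq_vec_wires => d.
by rewrite red_cons -map_comp.
Qed.

End Bounded.

(** * A tower of finite fields and Moore matrices *)

(** The additive group of F is an elementary abelian 2-group, hence isomorphic to GF(2)^m.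
    Additivity of [fb] turns field addition into exclusive or. *)
Lemma finField_bits (F : finFieldType) m : #|F| = (2 ^ m)%N ->
  exists2 fb : F -> {ffun 'I_m -> bool}, {morph fb : x y / x + y} & bijective fb.
Proof.
move=> cardF; have char2: 2 \in [pchar F] by apply: card_finPcharP cardF _.
have abF: (2.-abelem [set: F])%g by apply: fin_ring_pchar_abelem.
have abV: (2.-abelem [set: 'rV[bool]_m])%g.
  apply/abelemP => //; split; first exact: FinRing.zmod_abelian.
  move=> x _; apply/rowP => i; rewrite FinRing.zmodXgE mxE.
  by rewrite [RHS]mxE; case: (x 0 i : bool).
have /isog_isom/=[f /isomP[injf im_f]]: ([set: F] \isog [set: 'rV[bool]_m])%g.
  by rewrite (isog_abelem_card _ abF) abV !cardsT card_mx mul1n card_bool cardF /=.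
have fD x y : f (x + y) = f x + f y by rewrite -[x + y]/(x * y)%g morphM ?inE.
exists (fun x => [ffun i => f x 0 i]) => [x y|].
  by apply/ffunP => i; rewrite !ffunE fD mxE.
exists (fun v : {ffun _ -> _} => invm injf (\row_i v i)) => [x|v].
  rewrite -[RHS](invmE injf) ?inE //; congr (invm injf _).
  by apply/rowP => i; rewrite mxE ffunE.
by apply/ffunP => i; rewrite ffunE invmK ?mxE // im_f inE.
Qed.

(** L is the splitting field of X^(q^N) - X. This polynomial is separable, its derivative being -1,
    and its roots are the fixed points of the N-th power of the Frobenius map, which form a
    subfield. So the roots fill L, and |L| = q^N gives the degree. *)
Lemma finField_ext (F : finFieldType) N : 2 \in [pchar F] -> (0 < N)%N ->
  exists L : fieldExtType F, \dim {:L} = N.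
Proof.
move=> char2 N_gt0; pose q := #|F|; pose m := (q ^ N)%N.
have q_gt1 : (1 < q)%N by apply: finNzRing_gt1.
have m_gt1 : (1 < m)%N by rewrite -(exp1n N) ltn_exp2r.
have szP (K : fieldType) : size ('X^m - 'X : {poly K}) = m.+1.
  by rewrite size_polyDl size_polyXn // size_polyN size_polyX.
have nzP (K : fieldType) : 'X^m - 'X != 0 :> {poly K} by rewrite -size_poly_gt0 szP.
have [L splitL] := FinSplittingFieldFor (nzP F).
rewrite rmorphB rmorphXn /= map_polyX in splitL.
exists L; have [zs DqL defL] := splitL.
have char2L : 2 \in [pchar L] by rewrite pchar_lalg.
have q0 : q%:R = 0 :> L.
  have cardF := card_pprimeChar char2; rewrite /q cardF natrX pcharf0 //.
  have: (0 < logn 2 #|F|)%N; last by rewrite expr0n; case: (logn _ _).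
  by rewrite -(ltn_exp2l 0 _ (ltnSn 1)) -cardF.
have m0 : m%:R = 0 :> L by rewrite natrX q0 expr0n -(prednK N_gt0).
have Uzs : uniq zs.
  rewrite -separable_prod_XsubC -(eqp_separable DqL).
  rewrite unlock !derivE -mulr_natl -polyC_natr m0 mul0r sub0r.
  by rewrite -(scaleN1r 1) coprimepZr ?coprimep1 ?oppr_eq0 ?oner_eq0.
have zsE z : (z \in zs) = (z ^+ m == z).
  by rewrite -root_prod_XsubC -(eqp_root DqL) /root !hornerE subr_eq0.
have sz_zs : size zs = m.
  apply: succn_inj; rewrite -(size_prod_XsubC _ id) -(eqp_size DqL) szP //.
have [a _ Da] := finField_galois_generator (sub1v {:L}).
pose E := fixedSpace (a ^+ N)%g.
have memE z : (z \in E) = (z ^+ m == z).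
  rewrite (sameP fixedSpaceP eqP); congr (_ == z).
  rewrite /m; elim: (N) => [|i IH]; first by rewrite gal_id.
  rewrite expgSr expnSr exprM -IH galM ?memvf // Da ?memvf //. by rewrite dimv1 expn1.
have allL (z : L) : z ^+ m = z.
  suffices defE: E = {:L}%VS.
    by have := memvf z; rewrite -defE memE => /eqP.
  apply/eqP; rewrite eqEsubv subvf -defL -[X in (_ <= X)%VS]subfield_closed agenvS //.
  by rewrite subv_add sub1v; apply/span_subvP=> y; rewrite zsE memE.
have cardL : #|finvect_type L| = (q ^ \dim {:L})%N.
  by have := card_vspacef (Vector.class (finvect_type L)); rewrite card_vspace => <-.
apply/eqP; rewrite -(eqn_exp2l _ _ q_gt1) -cardL -/m -sz_zs.
have /card_uniqP <- : @uniq (finvect_type L) zs := Uzs.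
by apply/eqP/eq_card => z; rewrite inE zsE; apply/esym/eqP/allL.
Qed.

Lemma field_tower m N : (0 < m)%N -> (0 < N)%N ->
  exists (F L : finFieldType) (iota : {rmorphism F -> L}) (theta : 'I_N -> L)
         (crd : L -> 'rV[F]_N),
    [/\ #|F| = (2 ^ m)%N, forall x, \sum_b iota (crd x 0 b) * theta b = x &
        forall v : 'rV[F]_N, crd (\sum_b iota (v 0 b) * theta b) = v].
Proof.
move=> m_gt0 N_gt0.
have [F char2 cardF] := pPrimePowerField (isT : prime 2) m_gt0.
have [L dimL] := finField_ext char2 N_gt0.
have b_free := basis_free (vbasisP {:L}).
pose theta (b : 'I_N) := (vbasis {:L})`_b.
pose crd (x : L) : 'rV[F]_N := \row_b coord (vbasis {:L}) (cast_ord (esym dimL) b) x.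
exists F, (finvect_type L), (GRing.in_alg (finvect_type L)), theta, crd.
split=> // [x|v].
  have {2}-> := coord_vbasis (memvf (x : L)); rewrite (reindex (cast_ord (esym dimL))) /=.
    by apply: eq_bigr => b _; rewrite mxE mulr_algl.
  by exists (cast_ord dimL) => b _; apply: val_inj.
apply/rowP=> b; rewrite mxE (reindex (cast_ord dimL)) /=; last first.
  by exists (cast_ord (esym dimL)) => c _; apply: val_inj.
under eq_bigr do rewrite mulr_algl.
rewrite (coord_sum_free (fun i => v 0 (cast_ord dimL i)) _ b_free) //.
by congr (v _ _); apply: val_inj.
Qed.

Lemma row_free_sub (F : fieldType) m n (K : 'M[F]_(m, n)) t :
  (t <= \rank K)%N -> exists2 B : 'M_(t, n), row_free B & (B <= K)%MS.
Proof.
move=> le_t; exists ((pid_mx t : 'M_(t, _)) *m row_base K).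
  by rewrite /row_free mxrankMfree ?row_base_free // rank_pid_mx.
by apply: submx_trans (submxMl _ _) _; rewrite eq_row_base.
Qed.

(** Reduces an arbitrary tap to one of full rank: as B = E B1, whoever observes through [B1] learns
    at least as much. *)
Lemma row_free_sup (F : fieldType) m n (B : 'M[F]_(m, n)) :
  (m <= n)%N -> exists2 B1 : 'M_(m, n), row_free B1 & (B <= B1)%MS.
Proof.
move=> le_mn; exists ((pid_mx m : 'M_(m, n)) *m row_ebase B).
  by rewrite /row_free mxrankMfree ?row_free_unit ?row_ebase_unit // rank_pid_mx.
rewrite -{1}(mulmx_ebase B) -mulmxA.
have -> : pid_mx (\rank B) = (pid_mx (\rank B) : 'M[F]_m) *m (pid_mx m : 'M_(m, n)).
  by rewrite mul_pid_mx (minn_idPl (rank_leq_row B)) (minn_idPr (rank_leq_row B)).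
by rewrite -!mulmxA mulmxA submxMl.
Qed.

Section Moore.

Variables (F L : finFieldType) (iota : {rmorphism F -> L}).
Variables (N : nat) (theta : 'I_N -> L).
Hypothesis theta_free : forall v : 'rV[F]_N,
  \sum_b iota (v 0 b) * theta b = 0 -> v = 0.

(** Generator matrix of a Gabidulin code. Frobenius powers are F-linear, so left multiplication by a
    matrix over F gives the Moore matrix of the corresponding F-combinations of [theta]. *)
Definition moore t : 'M[L]_(N, t) := \matrix_(k, j) theta k ^+ (#|F| ^ j).

Lemma frob_sum j (I : finType) (x : I -> L) :
  (\sum_i x i) ^+ (#|F| ^ j) = \sum_i x i ^+ (#|F| ^ j).
Proof.
have [p p_pr pcharF] := finPcharP F.
have pcharL : p \in [pchar L] by rewrite (fmorph_pchar iota).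
have pq : p.-nat (#|F| ^ j)%N.
  by rewrite pnatX; apply/orP; left; rewrite (card_pprimeChar pcharF) pnatX pnat_id.
apply: (big_morph (fun x : L => x ^+ (#|F| ^ j))) => [y z|].
  by apply: exprDn_pchar; apply: sub_in_pnat pq => r _ /eqP->.
by rewrite expr0n expn_eq0 -leqn0 leqNgt (ltn_trans _ (finNzRing_gt1 F)).
Qed.

Lemma expf_iota j (a : F) : iota a ^+ (#|F| ^ j) = iota a.
Proof.
elim: j => [|j IH]; first by rewrite expr1.
by rewrite expnSr exprM IH -rmorphXn expf_card.
Qed.

Lemma moore_unit t (B : 'M[F]_(t, N)) :
  row_free B -> map_mx iota B *m moore t \in unitmx.
Proof.
move=> freeB; rewrite -unitmx_tr -row_free_unit -kermx_eq0.
apply/rowV0P => c /sub_kermxP cG.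
case: t B freeB c cG => [|t] B freeB c cG; first by apply/rowP; case.
pose x (a : 'rV[F]_t.+1) := \sum_k iota ((a *m B) 0 k) * theta k.
pose p := \sum_(j < t.+1) c 0 j *: 'X^(#|F| ^ j).
have q_gt1 := finNzRing_gt1 F.
(* [p] vanishes at the q^t distinct points [x a], but has degree below q^t. *)
have root_p a : root p (x a).
  apply/eqP; rewrite horner_sum.
  transitivity ((map_mx iota a *m (c *m (map_mx iota B *m moore t.+1)^T)^T) 0 0).
    rewrite trmx_mul trmxK !mulmxA -map_mxM mxE; apply: eq_bigr => j _.
    rewrite hornerE hornerXn frob_sum !mxE mulrC big_distrl big_distrl /=.
    apply: eq_bigr => k _.
    by rewrite exprMn expf_iota !mxE.
  by rewrite cG trmx0 mulmx0 mxE.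
have x_inj : injective x.
  move=> a b eq_x; apply: (row_free_inj freeB); apply/eqP.
  rewrite -subr_eq0; apply/eqP/theta_free.
  rewrite -[RHS](subrr (x a)) {2}eq_x /x -sumrB; apply: eq_bigr => k _.
  by rewrite !mxE rmorphB mulrBl.
have p0 : p = 0.
  apply: contraTeq isT => nz_p.
  have := max_poly_roots nz_p (rs := [seq x a | a : 'rV[F]_t.+1]).
  rewrite size_map -cardE card_mx mul1n map_inj_uniq ?enum_uniq //.
  have -> : all (root p) [seq x a | a : 'rV[F]_t.+1].
    by apply/allP => _ /mapP[a _ ->].
  move=> /(_ isT isT); rewrite ltnNge => /negP[].
  apply: leq_trans (_ : (#|F| ^ t).+1 <= _)%N; last by rewrite ltn_exp2l.
  rewrite (leq_trans (size_sum _ _ _)) //; apply/bigmax_leqP => j _.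
  rewrite (leq_trans (size_scale_leq _ _)) // size_polyXn ltnS leq_exp2l //.
  by rewrite -ltnS.
apply/rowP => j; rewrite mxE -(coef0 L (#|F| ^ j)) -p0 coef_sum (bigD1 j) //=.
rewrite coefZ coefXn eqxx mulr1 big1 ?addr0 // => i neq_ij.
rewrite coefZ coefXn eqn_exp2l // [in X in X%:R]eq_sym -val_eqE in neq_ij *.
by rewrite (negPf neq_ij) mulr0.
Qed.

End Moore.

Lemma mxrank_adds_row (F : fieldType) m n (A : 'M[F]_(m, n)) (v : 'rV[F]_n) :
  \rank (A + v)%MS = (\rank A + ~~ (v <= A)%MS)%N.
Proof.
have [sub_vA | nsub] := boolP (v <= A)%MS; first by rewrite addn0 (addsmx_idPl sub_vA).
apply/eqP; rewrite -(eqn_add2r (\rank (A :&: v)%MS)) mxrank_sum_cap.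
have nz_v: v != 0 by apply: contraNneq nsub => ->; apply: sub0mx.
have -> : \rank (A :&: v)%MS = 0%N.
  apply/eqP; rewrite mxrank_eq0; apply: contraNT nsub => nz_cap.
  have/mxrank_leqif_sup[_] := capmxSr A v.
  rewrite rank_rV nz_v eqn_leq lt0n mxrank_eq0 nz_cap andbT.
  have le1: (\rank (A :&: v)%MS <= 1)%N.
    by apply: leq_trans (mxrankS (capmxSr A v)) _; rewrite rank_rV nz_v.
  rewrite le1 => /esym sub; apply: submx_trans sub (capmxSl A v).
by rewrite addn0 rank_rV nz_v.
Qed.

Lemma row_pid_mx (F : fieldType) m n (M : 'M[F]_(m, n)) (k : nat) i :
  row i ((pid_mx k : 'M_m) *m M) = if (i < k)%N then row i M else 0.
Proof.
apply/rowP => j; rewrite !mxE (bigD1 i) //= big1 ?addr0 => [|l neq_li].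
  by rewrite mxE eqxx /=; case: ifP; rewrite !mxE ?mul1r ?mul0r.
by rewrite mxE eq_sym val_eqE (negPf neq_li) mul0r.
Qed.

(** [pid_mx k *m M] keeps the first [k] rows, so the rank is counted greedily, by the rows
    independent of their predecessors. This is the form in which [reach] counts dimensions. *)
Lemma mxrank_indep (F : fieldType) m n (M : 'M[F]_(m, n)) :
  \rank M = #|[set k : 'I_m | ~~ (row k M <= (pid_mx k : 'M_m) *m M)%MS]|.
Proof.
suffices rk k : (k <= m)%N -> \rank ((pid_mx k : 'M_m) *m M) =
    #|[set i : 'I_m | (i < k)%N && ~~ (row i M <= (pid_mx i : 'M_m) *m M)%MS]|.
  have := rk m (leqnn m); rewrite pid_mx_1 mul1mx => ->.
  by apply: eq_card => i; rewrite !inE ltn_ord.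
elim: k => [_|k IH lt_km].
  by rewrite pid_mx_0 mul0mx mxrank0; apply/esym/eqP; rewrite cards_eq0;
     apply/eqP/setP => i; rewrite !inE.
pose i0 := Ordinal lt_km.
have eqS : ((pid_mx k.+1 : 'M_m) *m M :=: (pid_mx k : 'M_m) *m M + row i0 M)%MS.
  apply/eqmxP/andP; split.
    apply/row_subP => i; rewrite row_pid_mx ltnS leq_eqVlt.
    have [eq_ik | ne_ik] := eqVneq (i : nat) k.
      by rewrite (_ : i = i0) ?addsmxSr //; apply: val_inj.
    have := row_sub i ((pid_mx k : 'M_m) *m M); rewrite row_pid_mx /=.
    case: ifP => [_ sub_i|_ _]; last exact: sub0mx.
    exact: submx_trans sub_i (addsmxSl _ _).
  rewrite addsmx_sub; apply/andP; split.
    apply/row_subP => i; have := row_sub i ((pid_mx k.+1 : 'M_m) *m M).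
    rewrite !row_pid_mx; case: (ltnP i k) => [lt_ik|_ _]; last exact: sub0mx.
    by rewrite ltnS ltnW.
  by have := row_sub i0 ((pid_mx k.+1 : 'M_m) *m M); rewrite row_pid_mx leqnn.
rewrite eqS mxrank_adds_row IH ?(ltnW lt_km) // addnC.
rewrite [RHS](cardsD1 i0) inE leqnn /=; congr (_ + _)%N.
apply: eq_card => i; rewrite !inE -val_eqE /= ltnS [in RHS]leq_eqVlt.
by case: ltngtP.
Qed.

(** * The rank test for key bits and the rows that escape jamming *)

Section Code.

Variables (F L : finFieldType) (iota : {rmorphism F -> L}).
Variables (C : nat) (theta : 'I_C -> L) (crd : L -> 'rV[F]_C).
Hypothesis crdK : forall x, \sum_b iota (crd x 0 b) * theta b = x.
Hypothesis combK : forall v : 'rV[F]_C, crd (\sum_b iota (v 0 b) * theta b) = v.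

Lemma theta_free (v : 'rV[F]_C) : \sum_b iota (v 0 b) * theta b = 0 -> v = 0.
Proof.
move=> v0; rewrite -[v]combK v0 -[RHS]combK; congr crd.
by rewrite big1 // => b _; rewrite mxE rmorph0 mul0r.
Qed.

Lemma crd_comb (I : finType) (a : I -> F) (x : I -> L) :
  crd (\sum_i iota (a i) * x i) = \sum_i a i *: crd (x i).
Proof.
rewrite -[RHS]combK; congr crd.
transitivity (\sum_i \sum_b iota (a i) * (iota (crd (x i) 0 b) * theta b)).
  by apply: eq_bigr => i _; rewrite -{1}[x i]crdK mulr_sumr.
rewrite exchange_big; apply: eq_bigr => b _.
rewrite summxE rmorph_sum mulr_suml; apply: eq_bigr => i _.
by rewrite mxE rmorphM mulrA.
Qed.

Lemma crdD : {morph crd : x y / x + y}.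
Proof.
move=> x y; have := crd_comb (fun=> 1) (fun i : bool => if i then x else y).
rewrite !big_bool /= rmorph1 !mul1r !scale1r //.
Qed.

Local Notation "A ^i" := (map_mx iota A) (at level 8, format "A ^i").
Local Notation moore := (moore F theta).

Definition coords (tau : 'rV[L]_C) : 'M[F]_C := \matrix_(k, b) crd (tau 0 k) 0 b.

Lemma row_coords tau k : row k (coords tau) = crd (tau 0 k).
Proof. by apply/rowP => b; rewrite !mxE. Qed.

Section Reach.

Variables (w : nat) (Y : 'M[L]_(C, w)).

(* The number of unit vectors that are not reached is the codimension in F^C of
   the F-rational points of the column space of [Y]. *)
Definition reach (k : 'I_C) := exists (x : 'cV[L]_w) (y : 'rV[F]_C),
  (forall i : 'I_C, (k <= i)%N -> y 0 i = 0) /\ Y *m x + (y^i)^T = delta_mx k 0.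

(** Applying [tau], which kills [Y], to the equation that reaches [k] expresses [tau 0 k] as an
    F-combination of earlier entries. Only the indices in [fl] can contribute to the F-rank. *)
Lemma reach_rank (fl : {set 'I_C}) (tau : 'rV[L]_C) :
  (forall k, k \notin fl -> reach k) -> tau *m Y = 0 ->
  (\rank (coords tau) <= #|fl|)%N.
Proof.
move=> fl_reach tauY; rewrite mxrank_indep; apply/subset_leq_card/subsetP => k.
rewrite inE; apply: contraR => /fl_reach[x [y [y0 defk]]].
have tauk : tau 0 k = \sum_i iota (y 0 i) * tau 0 i.
  have := congr1 (mulmx tau) defk; rewrite mulmxDr mulmxA tauY mul0mx add0r.
  move=> /(congr1 (fun M : 'M_1 => M 0 0)); rewrite !mxE => /esym.
  rewrite (bigD1 k) //= big1 ?addr0 => [|i neq_ik]; last first.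
    by rewrite mxE (negPf neq_ik) mulr0.
  rewrite mxE !eqxx mulr1 => ->; apply: eq_bigr => i _.
  by rewrite !mxE mulrC.
have -> : row k (coords tau) =
   y *m ((pid_mx k : 'M_C) *m coords tau).
  rewrite row_coords tauk crd_comb mulmx_sum_row; apply: eq_bigr => i _.
  rewrite row_pid_mx row_coords; case: ltnP => // le_ki.
  by rewrite y0 // !scale0r.
exact: submxMl.
Qed.

(** If column [k] of [B] is a combination [y] of the earlier ones, then [B] kills v = e_k - y. So
    does the left kernel of [Y], hence [v] lies in the column space of [Y] and [k] is reached. The
    unreached indices therefore number at most the rank of [B]. *)
Lemma not_reach_rank (fl : {set 'I_C}) t (B : 'M[F]_(t, C)) :
  (forall k, k \in fl -> ~ reach k) ->
  (forall tau : 'rV[L]_C, tau *m Y = 0 -> (tau <= B^i)%MS) -> (#|fl| <= t)%N.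
Proof.
move=> fl_nreach kerB; apply: leq_trans (rank_leq_row B).
rewrite -mxrank_tr mxrank_indep; apply/subset_leq_card/subsetP => k fl_k.
rewrite inE; apply: contra_notN (fl_nreach k fl_k) => /submxP[y' defk].
pose y := y' *m (pid_mx k : 'M_C).
have y0 (i : 'I_C) : (k <= i)%N -> y 0 i = 0.
  move=> le_ki; rewrite mxE big1 // => j _; rewrite mxE.
  by case: eqP => [-> | _]; rewrite ?mulr0 // ltnNge le_ki mulr0.
pose v : 'cV[L]_C := delta_mx k 0 - (y^i)^T.
have Bv : B^i *m v = 0.
  apply/eqP; rewrite mulmxBr subr_eq0; apply/eqP.
  apply: (can_inj trmxK); rewrite !trmx_mul trmxK trmx_delta -rowE map_trmx.
  by rewrite -map_mxM /y -mulmxA -defk map_row.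
have /submxP[x defv] : (v^T <= Y^T)%MS.
  rewrite submxE; apply/eqP; apply: (can_inj trmxK).
  rewrite trmx_mul trmxK trmx0; apply/row_matrixP => i.
  rewrite row_mul row0; have /submxP[l ->] : (row i (cokermx Y^T)^T <= B^i)%MS.
    apply: kerB; rewrite -row_mul -[Y in _ *m Y]trmxK -trmx_mul mulmx_coker.
    by rewrite trmx0 row0.
  by rewrite -mulmxA Bv mulmx0.
exists x^T, y; split=> //; rewrite -[Y *m _]trmxK trmx_mul trmxK -defv trmxK.
by rewrite subrK.
Qed.

End Reach.

Variables (ZI R ZO : nat).
Hypothesis CE : (ZI + R + ZO = C)%N.
Hypothesis R_gt0 : (0 < R)%N.

Variables (A : 'M[F]_C) (n : nat) (Z : 'M[F]_(C, n)).
Hypotheses (A_unit : A \in unitmx) (rankZ : (\rank Z <= ZO)%N).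

Lemma jam_free_rows : exists2 Bz : 'M[F]_(ZI + R, C), row_free Bz & Bz *m Z = 0.
Proof.
have [|Bz freeB sub] := @row_free_sub F C C (kermx Z) (ZI + R).
  by rewrite mxrank_ker leq_subRL ?rank_leq_row // -{2}CE addnC leq_add2l.
by exists Bz => //; apply/sub_kermxP.
Qed.

(** [U] depends on [A] and [Z], so Bob cannot compute it. Its existence guarantees that the message
    rows are among the L-combinations of the rows received. *)
Lemma decoding_rows : exists U : 'M[L]_(ZI + R, C),
  U *m (A^i *m moore (ZI + R)) = 1%:M /\ U *m Z^i = 0.
Proof.
have [Bz freeB BZ0] := jam_free_rows.
have freeBA : row_free (Bz *m A) by rewrite /row_free mxrankMfree ?row_free_unit.
have unitG := moore_unit theta_free freeBA; rewrite map_mxM in unitG.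
exists (invmx (Bz^i *m A^i *m moore (ZI + R)) *m Bz^i).
rewrite -!mulmxA -map_mxM BZ0 map_mx0 mulmx0; split=> //.
by rewrite [Bz^i *m _]mulmxA mulVmx.
Qed.

(** The ZI + R rows [Bz] that escape the jamming outnumber the columns of [moore ZI], so a nonzero
    combination [tau] of them kills the matrix received. If its F-rank were at most ZI, [moore_unit]
    would force it to vanish. *)
Lemma bit0_flags w (M : 'M[L]_(ZI, w)) (E : 'M[L]_(n, w)) (fl : {set 'I_C}) :
  (forall k, k \notin fl -> reach (A^i *m (moore ZI *m M) + Z^i *m E) k) ->
  (ZI < #|fl|)%N.
Proof.
move=> fl_reach; have [Bz freeB BZ0] := jam_free_rows.
have [mu nz_mu mu0] : exists2 mu : 'rV[L]_(ZI + R), mu != 0 &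
    mu *m (Bz^i *m (A^i *m moore ZI)) = 0.
  have : kermx (Bz^i *m (A^i *m moore ZI)) != 0.
    rewrite -mxrank_eq0 mxrank_ker subn_eq0 -ltnNge.
    apply: leq_ltn_trans (rank_leq_col _) _.
    by rewrite -[X in (X < _)%N]addn0 ltn_add2l.
  by case/rowV0Pn => mu /sub_kermxP mu0 nz; exists mu.
have [tau [nz_tau tauG tauZ]] : exists tau : 'rV[L]_C,
    [/\ tau *m A^i != 0, tau *m A^i *m moore ZI = 0 & tau *m Z^i = 0].
  exists (mu *m Bz^i); split.
  - apply: contraNneq nz_mu => tauA0; have Au : A^i \in unitmx by rewrite map_unitmx.
    have freeBi : row_free Bz^i by rewrite row_free_map.
    rewrite -(inj_eq (row_free_inj freeBi)) mul0mx -[_ *m _](mulmxK Au).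
    by rewrite tauA0 mul0mx.
  - by rewrite -!mulmxA mu0.
  - by rewrite -mulmxA -map_mxM BZ0 map_mx0 mulmx0.
have tauY : tau *m (A^i *m (moore ZI *m M) + Z^i *m E) = 0.
  by rewrite mulmxDr !mulmxA tauG tauZ !mul0mx addr0.
rewrite ltnNge; apply: contra nz_tau => le_fl.
have := leq_trans (reach_rank fl_reach tauY) le_fl => le_rk.
(* Rank factorization over F: [tau *m A^i] becomes a combination [lam] of the [r] independent rows
   of [B1], with r <= ZI. *)
pose TT := coords tau; pose r := \rank TT.
pose B1 := (col_base TT)^T *m A.
have freeB1 : row_free B1.
  rewrite /row_free mxrankMfree ?row_free_unit // mxrank_tr.
  exact: col_base_full.
pose lam : 'rV[L]_r := \row_a \sum_b iota (row_base TT a b) * theta b.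
have tauE : tau *m A^i = lam *m B1^i.
  rewrite map_mxM mulmxA; congr (_ *m _); apply/rowP => k; rewrite [RHS]mxE.
  have -> : tau 0 k = \sum_b iota (TT k b) * theta b.
    by rewrite -{1}[tau 0 k]crdK; apply: eq_bigr => b _; rewrite mxE.
  rewrite -{1}(mulmx_base TT); under eq_bigr => b _ do rewrite mxE rmorph_sum mulr_suml.
  rewrite exchange_big; apply: eq_bigr => a _; rewrite !mxE mulr_suml.
  by apply: eq_bigr => b _; rewrite rmorphM -mulrA mulrC.
have lam0 : lam *m (B1^i *m moore r) = 0.
  rewrite mulmxA -tauE; apply/rowP => j.
  have := congr1 (fun v : 'rV_ZI => v 0 (widen_ord le_rk j)) tauG.
  rewrite mxE [RHS]mxE => tau0; rewrite [RHS]mxE -[RHS]tau0 mxE.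
  by apply: eq_bigr => k _; congr (_ * _); rewrite !mxE.
have := congr1 (mulmx^~ (invmx (B1^i *m moore r))) lam0.
by rewrite mulmxK ?(moore_unit theta_free) // mul0mx tauE => ->; rewrite mul0mx.
Qed.

End Code.

(** * The converse *)

Section Push.

Variables (R : realType) (W T : finType) (f : W -> T).
Hypothesis W_gt0 : (0 < #|W|)%N.

Definition push_mass (t : T) : R := #|[pred w | f w == t]|%:R / #|W|%:R.

Lemma push_massE t : push_mass t = #|W|%:R^-1 * \sum_w (f w == t)%:R.
Proof.
rewrite /push_mass mulrC; congr (_ * _); rewrite -natr_sum -sum1_card big_mkcond /=.
by congr (_%:R); apply: eq_bigr => w _; rewrite inE; case: eqP.
Qed.

Lemma sum_push_mass (g : T -> R) :
  \sum_t push_mass t * g t = #|W|%:R^-1 * \sum_w g (f w).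
Proof.
under eq_bigr do rewrite push_massE -mulrA.
rewrite -mulr_sumr; congr (_ * _); under eq_bigr do rewrite mulr_suml.
rewrite exchange_big; apply: eq_bigr => w _.
rewrite (bigD1 (f w)) //= eqxx mul1r big1 ?addr0 // => t /negPf neq.
by rewrite eq_sym neq mul0r.
Qed.

Lemma push_mass_ge0 t : 0 <= push_mass t.
Proof. by rewrite divr_ge0 ?ler0n. Qed.

Lemma push_mass_sum1 : \sum_t push_mass t = 1.
Proof.
under eq_bigr do rewrite -[push_mass _]mulr1.
by rewrite sum_push_mass sumr_const mulVf // pnatr_eq0 -lt0n.
Qed.

Definition push : fdist R T := FDist push_mass_ge0 push_mass_sum1.

End Push.

(** * Zero mutual information and independence *)

Section MutualInfo.

Variables (R : realType) (T U : finType) (p : T -> U -> R).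
Hypothesis p_ge0 : forall t u, 0 <= p t u.
Hypothesis p_sum1 : \sum_t \sum_u p t u = 1.

Let a t := \sum_u p t u.
Let b u := \sum_t p t u.

(** Strictness is drawn from the weak inequality at y = sqrt x: ln x = 2 ln y <= 2 (y - 1) < y^2 -
    1. *)
Lemma lt_ln_subr1 (x : R) : 0 < x -> x != 1 -> ln x < x - 1.
Proof.
move=> x_gt0 x_neq1; pose y := Num.sqrt x.
have y_gt0 : 0 < y by rewrite sqrtr_gt0.
have xE : x = y ^+ 2 by rewrite sqr_sqrtr // ltW.
have y_neq1 : y - 1 != 0.
  by rewrite subr_eq0; apply: contra x_neq1 => /eqP y1; rewrite xE y1 expr1n.
have : ln y <= y - 1.
  have := @le_ln1Dx R (y - 1); rewrite [1 + _]addrC subrK; apply.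
  by rewrite ltrBrDr addNr.
have : 0 < (y - 1) ^+ 2 by rewrite exprn_even_gt0 // y_neq1 orbT.
by rewrite xE lnXn // mulr2n; nra.
Qed.

Lemma marg_ge t u : p t u <= a t /\ p t u <= b u.
Proof.
split; rewrite /a /b; [rewrite (bigD1 u) | rewrite (bigD1 t)] => //=;
  by rewrite lerDl sumr_ge0.
Qed.

(* Gibbs' inequality: each summand dominates [p t u - a t * b u], with equality
   only at independence, and these lower bounds add up to 0. *)
Lemma mutual_info0_indep : mutual_info p = 0 -> forall t u, p t u = a t * b u.
Proof.
move=> I0.
have term t u : p t u - a t * b u <= p t u * ln (p t u / (a t * b u))
    ?= iff (p t u == a t * b u).
  have a_ge0 : 0 <= a t by rewrite sumr_ge0.
  have b_ge0 : 0 <= b u by rewrite sumr_ge0.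
  have [p0|nz] := eqVneq (p t u) 0.
    split; rewrite p0 mul0r sub0r ?oppr_le0 ?mulr_ge0 //.
    by rewrite oppr_eq0 eq_sym.
  have p_gt0 : 0 < p t u by rewrite lt_def nz p_ge0.
  have [le_a le_b] := marg_ge t u.
  have q_gt0 : 0 < a t * b u by rewrite mulr_gt0 // (lt_le_trans p_gt0).
  have [eq_pq|neq] := eqVneq (p t u) (a t * b u).
    by rewrite eq_pq subrr (divff (lt0r_neq0 q_gt0)) ln1 mulr0; split; rewrite ?eqxx.
  have lt_pq : p t u - a t * b u < p t u * ln (p t u / (a t * b u)).
    pose x := a t * b u / p t u.
    have x_gt0 : 0 < x by apply: divr_gt0.
    have x_neq1 : x != 1.
      by apply: contra neq => /eqP x1; rewrite -(divfK nz (a t * b u)) -/x x1 mul1r.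
    have lt_x := lt_ln_subr1 x_gt0 x_neq1.
    have -> : p t u / (a t * b u) = x^-1 by rewrite invf_div.
    have -> : a t * b u = p t u * x by rewrite [RHS]mulrC divfK.
    by rewrite lnV ?posrE //; nra.
  by split; [exact: ltW | rewrite lt_eqF].
have sum0 : \sum_t \sum_u (p t u - a t * b u) = 0.
  under eq_bigr do rewrite sumrB -mulr_sumr.
  rewrite sumrB p_sum1 -mulr_suml.
  have -> : \sum_t a t = 1 by [].
  by rewrite /b exchange_big p_sum1 mul1r subrr.
have := leif_sum (fun t (_ : true) => leif_sum (fun u (_ : true) => term t u)).
rewrite sum0 -/(mutual_info p) I0 => -[_]; rewrite eqxx => /esym/forallP all_eq t u.
by have /forallP/(_ u)/eqP := all_eq t.
Qed.

Lemma mutual_info_const (f : U -> R) :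
  (forall t u, p t u = #|T|%:R^-1 * f u) -> mutual_info p = 0.
Proof.
move=> pE; have T_gt0 : #|T|%:R != 0 :> R.
  rewrite pnatr_eq0; apply: contra_eqN p_sum1 => /eqP/fintype0 noT.
  by rewrite big1 ?(eq_sym 0) ?oner_eq0 // => t; case: (noT t).
have f1 : \sum_u f u = 1.
  rewrite -p_sum1 exchange_big; apply: eq_bigr => u _.
  under eq_bigr do rewrite pE.
  by rewrite sumr_const -[RHS]mulr_natl mulrA divff // mul1r.
rewrite /mutual_info big1 // => t _; rewrite big1 // => u _.
have -> : \sum_u' p t u' = #|T|%:R^-1.
  by under eq_bigr do rewrite pE; rewrite -mulr_sumr f1 mulr1.
have -> : \sum_t' p t' u = f u.
  under eq_bigr do rewrite pE.
  by rewrite sumr_const -[LHS]mulr_natl mulrA divff // mul1r.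
have [p0|nz] := eqVneq (p t u) 0; first by rewrite p0 mul0r.
by rewrite -(pE t u) divff // ln1 mulr0.
Qed.

End MutualInfo.

Section SecretLaw.

Variables (R : realType) (F : finFieldType) (C n : nat) (sch : scheme R F C n).
Variables (ZI : nat) (B : 'M[F]_(ZI, C)).

Lemma msg_neq0 : #|msg sch|%:R != 0 :> R.
Proof. by rewrite pnatr_eq0 -lt0n msg_gt0. Qed.

Lemma eavesdrop_law_ge0 s w : 0 <= eavesdrop_law (sch := sch) B s w.
Proof. by rewrite mulr_ge0 ?invr_ge0 ?ler0n // sumr_ge0 // => X _; apply: pmf_ge0. Qed.

Lemma eavesdrop_law_marg s : \sum_w eavesdrop_law (sch := sch) B s w = #|msg sch|%:R^-1.
Proof.
rewrite -mulr_sumr -[RHS]mulr1 -(pmf_sum1 (enc s)); congr (_ * _).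
by rewrite [RHS](partition_big (fun X => B *m X) predT).
Qed.

Lemma eavesdrop_law_sum1 : \sum_s \sum_w eavesdrop_law (sch := sch) B s w = 1.
Proof.
under eq_bigr do rewrite eavesdrop_law_marg.
by rewrite sumr_const -[LHS]mulr_natl divff ?msg_neq0.
Qed.

Lemma secret_law : mutual_info (eavesdrop_law (sch := sch) B) = 0 ->
  forall s w, eavesdrop_law (sch := sch) B s w =
    #|msg sch|%:R^-1 * \sum_s' eavesdrop_law (sch := sch) B s' w.
Proof.
move=> I0 s w; rewrite (mutual_info0_indep eavesdrop_law_ge0 eavesdrop_law_sum1 I0).
by rewrite eavesdrop_law_marg.
Qed.

End SecretLaw.

(** * A bound on the number of messages *)

Section Converse.

Variables (R : realType) (F : finFieldType) (ZI D ZO n : nat).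
Variable sch : scheme R F (ZI + (D + ZO)) n.

Definition tap : 'M[F]_(ZI, ZI + (D + ZO)) := row_mx 1%:M 0.
Definition noise (Z : 'M[F]_(ZO, n)) : 'M[F]_(ZI + (D + ZO), n) :=
  col_mx 0 (col_mx 0 Z).

Lemma tap_mul (X : 'M[F]_(_, n)) : tap *m X = usubmx X.
Proof. by rewrite -[X in LHS]vsubmxK mul_row_col mul1mx mul0mx addr0. Qed.

Lemma rank_noise Z : (\rank (noise Z) <= ZO)%N.
Proof.
have -> : noise Z = col_mx 0 (col_mx 0 1%:M) *m Z.
  by rewrite !mul_col_mx !mul0mx mul1mx.
exact: leq_trans (mxrankM_maxr _ _) (rank_leq_row Z).
Qed.

Lemma unit_gt0 : (0 < #|{: unit}|)%N.
Proof. by rewrite card_unit. Qed.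

(** Constant strategies suffice: uniform noise is their average, and each of them already has to be
    defeated by the scheme. *)
Definition const_jam (Z : 'M[F]_(ZI + (D + ZO), n)) : strategy R F (ZI + (D + ZO)) n ZI :=
  fun=> push R (fun _ : unit => Z) unit_gt0.

Lemma const_jam_sum Z w (P : pred 'M[F]_(ZI + (D + ZO), n)) :
  \sum_(Z' | P Z') const_jam Z w Z' = (P Z)%:R.
Proof.
rewrite big_mkcond (eq_bigr (fun Z' => push_mass R (fun _ : unit => Z) Z' * (P Z')%:R)).
  by rewrite sum_push_mass card_unit invr1 mul1r big_const card_unit /= addr0.
by move=> Z' _; case: (P Z'); rewrite ?mulr1 ?mulr0.
Qed.

Lemma const_jam_rank Z : jams_at_most ZO (const_jam (noise Z)).
Proof.
move=> w Z' nz; suffices -> : Z' = noise Z by apply: rank_noise.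
apply: contraNeq nz => neq; have := const_jam_sum (noise Z) w (pred1 Z').
by rewrite big_pred1_eq /= => ->; rewrite [noise Z == _]eq_sym (negPf neq).
Qed.

Lemma success_gt (Z : 'M[F]_(ZO, n)) : error_less_than sch ZO ZI (1 / 2) ->
  1 / 2 < \sum_(s : msg sch) #|msg sch|%:R^-1 *
            \sum_X enc s X * (dec sch (X + noise Z) == s)%:R.
Proof.
move=> /(_ 1%:M tap (const_jam (noise Z)) (unitmx1 _ _) (@const_jam_rank Z)).
set succ := \sum_s _; suffices -> : error_prob sch 1%:M tap (const_jam (noise Z)) = 1 - succ by lra.
apply/eqP; rewrite eq_sym subr_eq eq_sym /succ -big_split /=; apply/eqP.
transitivity (\sum_(s : msg sch) #|msg sch|%:R^-1 : R); last first.
  by rewrite sumr_const -[LHS]mulr_natl divff ?msg_neq0.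
apply: eq_bigr => s _; rewrite -mulrDr -big_split /=.
rewrite (eq_bigr (enc s)) ?pmf_sum1 ?mulr1 // => X _.
rewrite (const_jam_sum _ (tap *m X)) /= mul1mx -mulrDr.
by case: eqP => _ /=; rewrite ?addr0 ?add0r mulr1.
Qed.

(** Summing over all noise [Z] makes the jammed rows uniform, hence useless to Bob. Summing over all
    values of the D clean rows, instead of the true one, costs a factor q^(D n). What is left
    depends on X through the tapped rows alone; by secrecy they are independent of the message,
    which is then guessed with probability 1 / |S|. *)
Lemma secret_reliable_card : perfectly_secret sch ZI ->
  error_less_than sch ZO ZI (1 / 2) ->
  #|msg sch|%:R < 2 * #|F|%:R ^+ (D * n) :> R.
Proof.
move=> /(_ tap) /secret_law law err.
pose g s (w : 'M[F]_(ZI, n)) (X2 : 'M[F]_(D, n)) : R :=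
  \sum_(Z : 'M[F]_(ZO, n)) (dec sch (col_mx w (col_mx X2 Z)) == s)%:R.
have g_ge0 s w X2 : 0 <= g s w X2 by apply: sumr_ge0.
have total : \sum_Z \sum_(s : msg sch) #|msg sch|%:R^-1 *
      \sum_X enc s X * (dec sch (X + noise Z) == s)%:R
    <= #|F|%:R ^+ (D * n) * #|F|%:R ^+ (ZO * n) / #|msg sch|%:R.
  apply: (@le_trans _ _ (\sum_(s : msg sch) #|msg sch|%:R^-1 *
     \sum_X enc s X * \sum_X2 g s (tap *m X) X2)).
    rewrite exchange_big /=; apply: ler_sum => s _.
    rewrite -mulr_sumr ler_wpM2l ?invr_ge0 ?ler0n // exchange_big /=.
    apply: ler_sum => X _; rewrite -mulr_sumr ler_wpM2l ?pmf_ge0 //.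
    rewrite (bigD1 (usubmx (dsubmx X))) //= -[X in X <= _]addr0 lerD ?sumr_ge0 //.
    rewrite le_eqVlt; apply/orP; left; apply/eqP.
    (* Translation by the jammed rows of [X] lets the last rows of [X + noise Z] run over all
       matrices. *)
    rewrite /g (reindex_inj (addIr (- dsubmx (dsubmx X)))) /=.
    apply: eq_bigr => Z _; rewrite tap_mul /noise.
    set c := dsubmx (dsubmx X); set b := usubmx (dsubmx X); set a := usubmx X.
    have XE : X = col_mx a (col_mx b c) by rewrite /a /b /c !vsubmxK.
    by rewrite [X in X + _]XE !add_col_mx !addr0 [c + _]addrC subrK.
  apply: (@le_trans _ _ (\sum_w \sum_X2 \sum_s eavesdrop_law (sch := sch) tap s w * g s w X2)).
    rewrite le_eqVlt; apply/orP; left; apply/eqP.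
    under [RHS]eq_bigr do rewrite exchange_big.
    rewrite [RHS]exchange_big; apply: eq_bigr => s _; rewrite mulr_sumr.
    under [RHS]eq_bigr do rewrite -mulr_sumr /eavesdrop_law -mulrA mulr_suml.
    rewrite -[RHS]mulr_sumr -[LHS]mulr_sumr; congr (_ * _).
    rewrite (partition_big (fun X => tap *m X) predT) //=.
    by apply: eq_bigr => w _; apply: eq_bigr => X /eqP ->.
  under eq_bigr => w _ do under eq_bigr => X2 _ do under eq_bigr => s _ do rewrite law.
  rewrite le_eqVlt; apply/orP; left; apply/eqP.
  have gs w X2 : \sum_s g s w X2 = #|F|%:R ^+ (ZO * n).
    rewrite /g exchange_big /= (eq_bigr (fun=> 1)) => [|Z _].
      by rewrite sumr_const card_mx natrX.
    rewrite (bigD1 (dec sch (col_mx w (col_mx X2 Z)))) //= eqxx big1 ?addr0 // => s neq.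
    by rewrite eq_sym (negPf neq).
  under eq_bigr => w _ do under eq_bigr => X2 _ do rewrite -mulr_sumr gs.
  rewrite (eq_bigr (fun w => #|F|%:R ^+ (D * n) * (#|msg sch|%:R^-1 *
      (\sum_s' eavesdrop_law (sch := sch) tap s' w) * #|F|%:R ^+ (ZO * n)))); last first.
    by move=> w _; rewrite sumr_const card_mx -[LHS]mulr_natl natrX.
  rewrite -mulr_sumr -mulr_suml -mulr_sumr exchange_big eavesdrop_law_sum1 mulr1.
  by rewrite -mulrA; congr (_ * _); rewrite mulrC.
have lower : \sum_(Z : 'M[F]_(ZO, n)) (1 / 2) < \sum_Z \sum_(s : msg sch) #|msg sch|%:R^-1 *
      \sum_X enc s X * (dec sch (X + noise Z) == s)%:R.
  by apply: ltr_sum => [|Z _]; [by apply/hasP; exists 0; rewrite ?mem_index_enum | apply: success_gt].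
have := lt_le_trans lower total; rewrite sumr_const card_mx -[X in X < _]mulr_natl natrX.
have S_gt0 : 0 < #|msg sch|%:R :> R by rewrite ltr0n msg_gt0.
have q_gt0 : 0 < #|F|%:R ^+ (ZO * n) :> R by rewrite exprn_gt0 // ltr0n; apply/card_gt0P; exists 0.
rewrite ltr_pdivlMr // => h.
have : #|F|%:R ^+ (ZO * n) * #|msg sch|%:R < #|F|%:R ^+ (ZO * n) * (2 * #|F|%:R ^+ (D * n)) :> R by nra.
by rewrite ltr_pM2l.
Qed.

End Converse.

Lemma converse (R : realType) (C ZO ZI : nat) (r : R) : (ZO + ZI < C)%N ->
  C%:R - ZO%:R - ZI%:R < r -> ~ achievable C ZO ZI r.
Proof.
move=> lt_C; have [D CE] : exists D, C = (ZI + (D + ZO))%N.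
  exists (C - (ZO + ZI))%N.
  by rewrite addnCA [(ZI + ZO)%N]addnC subnK // ltnW.
subst C; move=> lt_r ach; have {lt_r} lt_Dr : D%:R < r.
  by apply: le_lt_trans lt_r; rewrite !natrD; lra.
(* Half of the gap, so that r - delta is still D + delta. With n delta > 1 the excess of the rate is
   worth more than a factor q, whereas the cardinality bound allows only 2 <= q. *)
pose delta := (r - D%:R) / 2.
have delta_gt0 : 0 < delta by rewrite /delta; lra.
have [||N HN] := ach (1 / 2) delta; [lra | exact: delta_gt0 |].
pose n := maxn N (Num.bound delta^-1).+1.
have [F [sch [secret rate_ge reliable _]]] := HN n (leq_maxl _ _).
have n_gt : delta^-1 < n%:R.
  apply: lt_le_trans (archi_boundP _) _; first by rewrite invr_ge0 ltW.
  by rewrite ler_nat (leq_trans (leqnSn _)) // leq_maxr.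
have n_gt0 : 0 < n%:R :> R by apply: lt_trans n_gt; rewrite invr_gt0.
have card_lt := secret_reliable_card secret reliable.
have q_ge2 : 2 <= #|F|%:R :> R by rewrite ler_nat finNzRing_gt1.
have ln2_gt0 : 0 < ln 2 :> R by rewrite ln_gt0 // ltr1n.
have lnq : ln 2 <= ln #|F|%:R :> R by rewrite ler_ln ?posrE; lra.
have S_gt0 : 0 < #|msg sch|%:R :> R by rewrite ltr0n msg_gt0.
have q_gt0 : 0 < #|F|%:R :> R by lra.
have : ln #|msg sch|%:R < ln 2 + (D * n)%:R * ln #|F|%:R :> R.
  rewrite mulr_natl -lnXn // -lnM ?posrE ?exprn_gt0 //.
  by rewrite ltr_ln ?posrE ?mulr_gt0 ?exprn_gt0.
move: rate_ge; rewrite /rate /logb ler_pdivlMr // ler_pdivlMr; last by lra.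
have -> : r - delta = D%:R + delta by rewrite /delta; lra.
rewrite natrM => le1 lt2.
have : delta * n%:R * ln #|F|%:R < ln 2 by nra.
have : 1 < delta * n%:R by rewrite -ltr_pdivrMl // mulr1.
nra.
Qed.

(** * The code *)

(** Probabilities are handled as integer counts: a bound on the conditional probability given [i],
    uniform in [i], bounds the total probability. *)
Lemma leq_card_pairl (I J : finType) (P : pred (I * J)) c N :
  (forall i, c * #|[pred j | P (i, j)]| <= N)%N -> (c * #|P| <= #|I| * N)%N.
Proof.
move=> leN; have -> : #|P| = \sum_i #|[pred j | P (i, j)]|.
  rewrite -sum1_card (eq_bigl (fun p => P (p.1, p.2))); last by case.
  rewrite -(pair_big_dep xpredT (fun i j => P (i, j)) (fun _ _ => 1%N)) /=.
  by apply: eq_bigr => i _; rewrite sum1_card.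
rewrite big_distrr /= -sum_nat_const.
by apply: leq_sum => i _; apply: leN.
Qed.

Lemma leq_card_pairr (I J : finType) (P : pred (I * J)) c N :
  (forall j, c * #|[pred i | P (i, j)]| <= N)%N -> (c * #|P| <= #|J| * N)%N.
Proof.
move=> leN; pose P' (p : J * I) := P (p.2, p.1).
have -> : #|P| = #|P'|.
  have inj : injective (fun p : I * J => (p.2, p.1)) by case=> ? ? [? ?] [-> ->].
  rewrite -(card_image inj).
  apply: eq_card => -[j i]; apply/imageP/idP => [[[i' j'] Pij [-> ->]]|Pij] //.
  by exists (i, j).
exact: leq_card_pairl.
Qed.

(** The union bound in the same form. *)
Lemma leq_card_exists (I J : finType) (P : I -> pred J) c N :
  (forall i, c * #|P i| <= N)%N -> (c * #|[pred j | [exists i, P i j]]| <= #|I| * N)%N.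
Proof.
move=> leN; apply: (@leq_trans (c * \sum_i #|P i|)); last first.
  by rewrite big_distrr -sum_nat_const; apply: leq_sum => i _; apply: leN.
rewrite leq_mul2l; apply/orP; right.
rewrite -sum1_card; under [X in (_ <= X)%N]eq_bigr do rewrite -sum1_card.
rewrite (exchange_big_dep predT) //= big_mkcond; apply: leq_sum => j _.
rewrite inE; case: existsP => // -[i Pij].
by rewrite (bigD1 i) // leq_addr.
Qed.

Lemma ffun_boolDD (I : finType) (v : {ffun I -> bool}) : v + v = 0.
Proof. by apply/ffunP => i; rewrite !ffunE; case: (v i). Qed.

Lemma ffun_bool_sum (I : finType) (v : {ffun I -> bool}) :
  v = \sum_i (if v i then [ffun j => i == j] else 0).
Proof.
apply/ffunP => j; rewrite sum_ffunE (bigD1 j) //= big1 => [|i neq_ij].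
  by rewrite addr0; case: (v j) (erefl (v j)) => vj; rewrite ffunE ?eqxx.
by case: (v i); rewrite ffunE // (negPf neq_ij).
Qed.

Lemma eq_cols (T : Type) a b (M N : 'M[T]_(a, b)) :
  (forall c, col c M = col c N) -> M = N.
Proof.
by move=> eq_MN; apply/matrixP => i c; have /colP/(_ i) := eq_MN c; rewrite !mxE.
Qed.

Section Scheme.

Variables (F L : finFieldType) (iota : {rmorphism F -> L}).
Variables (C m : nat) (theta : 'I_C -> L) (crd : L -> 'rV[F]_C).
Hypothesis crdK : forall x, \sum_b iota (crd x 0 b) * theta b = x.
Hypothesis combK : forall v : 'rV[F]_C, crd (\sum_b iota (v 0 b) * theta b) = v.
Variables (fb : F -> {ffun 'I_m -> bool}) (bf : {ffun 'I_m -> bool} -> F).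
Hypotheses (fbD : {morph fb : x y / x + y}) (fbK : cancel fb bf) (bfK : cancel bf fb).

Local Notation "A ^i" := (map_mx iota A) (at level 8, format "A ^i").
Local Notation moore := (moore F theta).

Notation symb := ('I_C * 'I_m)%type.

(** Coordinates over GF(2) in the basis [beta]. [locked] keeps simplification from exposing [fb] and
    [crd]. *)
Definition bits (x : L) : {ffun symb -> bool} :=
  locked [ffun p => fb (crd x 0 p.1) p.2].

Lemma bitsE x p : bits x p = fb (crd x 0 p.1) p.2.
Proof. by rewrite /bits -lock ffunE. Qed.

Definition unbits (v : {ffun symb -> bool}) : L :=
  \sum_b iota (bf [ffun i => v (b, i)]) * theta b.

Lemma bitsK : cancel bits unbits.
Proof.
move=> x; rewrite -[RHS]crdK; apply: eq_bigr => b _; congr (iota _ * _).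
by rewrite -[RHS]fbK; congr bf; apply/ffunP => i; rewrite ffunE bitsE.
Qed.

Lemma unbitsK : cancel unbits bits.
Proof.
move=> v; apply/ffunP => -[b i]; rewrite bitsE /unbits.
rewrite (_ : \sum__ _ = \sum_b iota ((\row_b bf [ffun i => v (b, i)]) 0 b) * theta b).
  by rewrite combK mxE bfK ffunE.
by apply: eq_bigr => c _; rewrite mxE.
Qed.

Lemma bitsD : {morph bits : x y / x + y}.
Proof.
by move=> x y; apply/ffunP => p; rewrite ffunE !bitsE (crdD crdK combK) mxE fbD ffunE.
Qed.

Lemma bits0 : bits 0 = 0.
Proof. by apply: (addIr (bits 0)); rewrite -bitsD !add0r. Qed.

Lemma fb0 : fb 0 = 0.
Proof. by apply: (addIr (fb 0)); rewrite -fbD !add0r. Qed.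

Definition beta (b : symb) : L := unbits [ffun c => b == c].
Definition gamma (i : 'I_m) : F := bf [ffun j => i == j].

Lemma beta_sum x : x = \sum_b (if bits x b then beta b else 0).
Proof.
apply: (can_inj bitsK); rewrite (big_morph bits bitsD bits0) {1}[bits x]ffun_bool_sum.
by apply: eq_bigr => b _; case: ifP => // _; rewrite ?unbitsK ?bits0.
Qed.

Lemma gamma_sum y : y = \sum_i (if fb y i then gamma i else 0).
Proof.
apply: (can_inj fbK); rewrite (big_morph fb fbD fb0) {1}[fb y]ffun_bool_sum.
by apply: eq_bigr => b _; case: ifP => // _; rewrite ?bfK ?fb0.
Qed.

Lemma scale_beta a b (x : L) (M : 'M[L]_(a, b)) :
  x *: M = \sum_c (if bits x c then beta c else 0) *: M.
Proof.
apply/matrixP => i j; rewrite mxE {1}[x]beta_sum mulr_suml summxE.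
by apply: eq_bigr => c _; rewrite mxE.
Qed.

Lemma scale_gamma a b (y : F) (M : 'M[L]_(a, b)) :
  iota y *: M = \sum_c (if fb y c then iota (gamma c) else 0) *: M.
Proof.
apply/matrixP => i j; rewrite mxE {1}[y]gamma_sum rmorph_sum mulr_suml summxE.
by apply: eq_bigr => c _; rewrite mxE; case: ifP; rewrite ?rmorph0.
Qed.

Lemma LDD (x : L) : x + x = 0.
Proof. by apply: (can_inj bitsK); rewrite bitsD ffun_boolDD bits0. Qed.

(** * The rank test as elimination over GF(2) *)

Section Flags.

Variables (w : nat) (Y : 'M[L]_(C, w)).

Definition vbits (v : 'cV[L]_C) : {ffun 'I_C * symb -> bool} :=
  [ffun p => bits (v p.1 0) p.2].

Lemma vbitsD : {morph vbits : u v / u + v}.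
Proof. by move=> u v; apply/ffunP => p; rewrite !ffunE mxE bitsD ffunE. Qed.

Lemma vbits0 : vbits 0 = 0.
Proof. by apply/ffunP => p; rewrite !ffunE mxE bits0 ffunE. Qed.

Lemma vbits_inj : injective vbits.
Proof.
move=> u v /ffunP eq_uv; apply/colP => k; apply: (can_inj bitsK).
by apply/ffunP => b; have := eq_uv (k, b); rewrite !ffunE.
Qed.

(* Generators over GF(2) of the L-span of the columns of [Y] and of the F-span of
   the first [k] unit vectors. *)
Definition flag_gen (k : 'I_C) (r : 'I_w * symb + 'I_C * 'I_m) : 'cV[L]_C :=
  match r with
  | inl (c, b) => beta b *: col c Y
  | inr (i, a) => if (i < k)%N then iota (gamma a) *: delta_mx i 0 else 0
  end.

Definition flag_red (k : 'I_C) : {ffun 'I_C * symb -> bool} :=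
  red (enum {: 'I_C * symb})
    [seq vbits (flag_gen k r) | r <- enum {: 'I_w * symb + 'I_C * 'I_m}]
    (vbits (delta_mx k 0)).

Definition flag (k : 'I_C) : bool := [exists p, flag_red k p].

(** As every coordinate is a pivot, reduction yields 0 exactly on the span of the generators: a
    vector that reduces to 0 equals, in characteristic 2, the combination that was added to it. *)
Lemma flag_reach k : reflect (reach iota Y k) (~~ flag k).
Proof.
apply: (iffP idP) => [nfl | [x [y [y0 defk]]]]; last first.
  rewrite negb_exists; apply/forallP => p; apply/negbT.
  apply: red_eq0; last by rewrite mem_enum.
  move=> G G0 GD _ Grows.
  have Gsum (I : finType) (f : I -> 'cV[L]_C) :
      (forall i, G (vbits (f i))) -> G (vbits (\sum_i f i)).
    by move=> Gf; elim/big_ind: _ => [|u v Gu Gv|i _]; rewrite ?vbits0 ?vbitsD //; apply: GD.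
  have Gr r : G (vbits (flag_gen k r)) by apply/Grows/map_f; rewrite mem_enum.
  rewrite -defk vbitsD; apply: GD.
    have -> : Y *m x = \sum_c \sum_b (if bits (x c 0) b then beta b else 0) *: col c Y.
      apply/colP => i; rewrite mxE summxE; apply: eq_bigr => c _.
      by rewrite -scale_beta !mxE mulrC.
    apply: (Gsum _ _) => c; apply: (Gsum _ _) => b; case: ifP => _; last first.
      by rewrite scale0r vbits0.
    exact: (Gr (inl (c, b))).
  have -> : (y^i)^T = \sum_i \sum_a
     (if fb (y 0 i) a then iota (gamma a) else 0) *: delta_mx i 0 :> 'cV[L]_C.
    apply/colP => i; rewrite !mxE summxE; under eq_bigr do rewrite -scale_gamma.
    rewrite (bigD1 i) //= big1 => [|j neq_ji]; first by rewrite !mxE !eqxx mulr1 addr0.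
    by rewrite !mxE eq_sym (negPf neq_ji) mulr0.
  apply: (Gsum _ _) => i; apply: (Gsum _ _) => a; have := Gr (inr (i, a)); rewrite /=.
  have [_ Gi | le_ki _] := ltnP i k.
    by case: ifP => _; rewrite // scale0r vbits0.
  by rewrite y0 // fb0 ffunE scale0r vbits0.
have red0 : flag_red k = 0.
  apply/ffunP => p; rewrite ffunE; apply: contraNF nfl => redp.
  by apply/existsP; exists p.
pose G v := exists (x : 'cV[L]_w) (y : 'rV[F]_C),
   (forall i : 'I_C, (k <= i)%N -> y 0 i = 0) /\ v = vbits (Y *m x + (y^i)^T).
have [|||g [x [y [y0 defg]]]] := @red_sub _ (enum {: 'I_C * symb}) G
    [seq vbits (flag_gen k r) | r <- enum {: 'I_w * symb + 'I_C * 'I_m}]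
    (vbits (delta_mx k 0)).
- exists 0, 0; split=> [i _|]; first by rewrite mxE.
  by rewrite mulmx0 map_mx0 trmx0 addr0 vbits0.
- move=> u v [x [y [y0 ->]]] [x' [y' [y'0 ->]]]; exists (x + x'), (y + y').
  split=> [i le_ki|]; first by rewrite mxE y0 // y'0 // addr0.
  rewrite -vbitsD addrACA -mulmxDr map_mxD; congr vbits; congr (_ + _).
  by apply/colP => i; rewrite !mxE.
- move=> v /mapP[r _ ->]; case: r => [[c b]|[i a]] /=.
    exists (beta b *: delta_mx c 0), 0; split=> [i _|]; first by rewrite mxE.
    by rewrite -scalemxAr -colE map_mx0 trmx0 addr0.
  have [lt_ik | le_ki] := ltnP i k; last first.
    exists 0, 0; split=> [j _|]; first by rewrite mxE.
    by rewrite mulmx0 map_mx0 trmx0 addr0.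
  exists 0, (gamma a *: delta_mx 0 i); split=> [j le_kj|].
    rewrite !mxE; have [ji|_] := eqVneq j i; last by rewrite andbF mulr0.
    by rewrite -ji ltnNge le_kj in lt_ik.
  by rewrite mulmx0 add0r map_mxZ map_delta_mx linearZ /= trmx_delta.
rewrite -/(flag_red k) red0 => t0; exists x, y; split=> //.
apply: vbits_inj; rewrite -defg; apply: (addIr g).
by rewrite ffun_boolDD -t0.
Qed.

End Flags.

Variables (R l : nat).

(** Evaluation at C + 1 points: the hash of a nonzero row vanishes at a random key with probability
    at most (l / |L|)^(C+1), small enough for a union over the |L|^C combinations of the rows
    received. *)
Definition hash (w : 'rV[L]_l) (rho : 'rV[L]_C.+1) : 'rV[L]_C.+1 :=
  \row_k \sum_a w 0 a * rho 0 k ^+ a.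

Lemma hashD rho : {morph hash^~ rho : w v / w + v}.
Proof.
move=> w v; apply/rowP => k; rewrite !mxE -big_split /=.
by apply: eq_bigr => a _; rewrite mxE mulrDl.
Qed.

Lemma hash0 rho : hash 0 rho = 0.
Proof. by apply/rowP => k; rewrite !mxE big1 // => a _; rewrite mxE mul0r. Qed.

(** * Recovering a row from its hash *)

Section Solver.

Variables (Y : 'M[L]_(C, l)) (rho : 'rV[L]_C.+1).

Notation coord := ('I_C.+1 * symb + 'I_l * symb)%type.

Definition tagged_row (h : 'rV[L]_C.+1) (w : 'rV[L]_l) : {ffun coord -> bool} :=
  [ffun p => match p with
             | inl (k, b) => bits (h 0 k) b
             | inr (a, b) => bits (w 0 a) b
             end].

Definition pivots : seq coord := [seq inl p | p <- enum {: 'I_C.+1 * symb}].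

(* Combinations of the rows of [Y] are searched for together with their hashes;
   only the latter are pivots. *)
Definition solve_gen (r : 'I_C * symb) : 'rV[L]_l := beta r.2 *: row r.1 Y.

Definition solve_red (h : 'rV[L]_C.+1) : {ffun coord -> bool} :=
  red pivots [seq tagged_row (hash (solve_gen r) rho) (solve_gen r)
             | r <- enum {: 'I_C * symb}] (tagged_row h 0).

Definition solve (h : 'rV[L]_C.+1) : 'rV[L]_l :=
  \row_a unbits [ffun b => solve_red h (inr (a, b))].

Lemma tagged_rowD h1 w1 h2 w2 :
  tagged_row (h1 + h2) (w1 + w2) = tagged_row h1 w1 + tagged_row h2 w2.
Proof. by apply/ffunP => -[[k b]|[a b]]; rewrite !ffunE mxE bitsD ffunE. Qed.

Lemma tagged_row0 : tagged_row 0 0 = 0.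
Proof. by apply/ffunP => -[[k b]|[a b]]; rewrite !ffunE mxE bits0 ffunE. Qed.

(** The vector (h, 0) is the tagged row of u0 Y plus (0, u0 Y), and the latter vanishes on the
    pivots, so [red_eq0] applies. Reduction clears the tag, while the untagged part records the
    combination that was used. *)
Lemma solveP h :
  (exists u : 'rV[L]_C, hash (u *m Y) rho = h) ->
  exists2 u : 'rV[L]_C, hash (u *m Y) rho = h & solve h = u *m Y.
Proof.
case=> u0 hash_u0; pose tr w := tagged_row (hash w rho) w.
have trD w v : tr (w + v) = tr w + tr v by rewrite /tr hashD tagged_rowD.
have tr0 : tr 0 = 0 by rewrite /tr hash0 tagged_row0.
have red0 p : p \in pivots -> solve_red h p = false.
  apply: red_eq0 => G G0 GD GK Grows.
  have Gsum (I : finType) (f : I -> 'rV[L]_l) :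
      (forall i, G (tr (f i))) -> G (tr (\sum_i f i)).
    by move=> Gf; elim/big_ind: _ => [|u v Gu Gv|i _]; rewrite ?tr0 ?trD //; apply: GD.
  have Gr r : G (tr (solve_gen r)).
    apply: Grows; apply: (map_f (fun r => tr (solve_gen r))).
    by rewrite mem_enum.
  have -> : tagged_row h 0 = tr (u0 *m Y) + tagged_row 0 (u0 *m Y).
    rewrite -tagged_rowD hash_u0 addr0; congr tagged_row.
    by apply/rowP => a; rewrite [RHS]mxE LDD mxE.
  apply: GD; last by apply: GK => _ /mapP[[k b] _ ->]; rewrite ffunE mxE bits0 ffunE.
  have -> : u0 *m Y = \sum_k \sum_b (if bits (u0 0 k) b then beta b else 0) *: row k Y.
    rewrite mulmx_sum_row; apply: eq_bigr => k _; exact: scale_beta.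
  apply: (Gsum _ _) => k; apply: (Gsum _ _) => b; case: ifP => _.
    exact: (Gr (k, b)).
  by rewrite scale0r tr0.
pose G v := exists u : 'rV[L]_C, v = tr (u *m Y).
have [|||g [u defg]] := @red_sub _ pivots G
    [seq tr (solve_gen r) | r <- enum {: 'I_C * symb}] (tagged_row h 0).
- by exists 0; rewrite mul0mx tr0.
- by move=> v w [x ->] [y ->]; exists (x + y); rewrite mulmxDl trD.
- move=> v /mapP[[k b] _ ->]; exists (beta b *: delta_mx 0 k).
  by rewrite -scalemxAl -rowE.
rewrite -/(solve_red h) defg => redE; exists u; apply/rowP => a.
  apply: (can_inj bitsK); apply/ffunP => b.
  have /red0 : inl (a, b) \in pivots by apply/map_f; rewrite mem_enum.
  rewrite redE 3!ffunE.
  by case: (bits (h 0 a) b); case: (bits _ b).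
rewrite mxE; apply: (can_inj bitsK); rewrite unbitsK; apply/ffunP => b.
by rewrite ffunE redE 3!ffunE mxE bits0 ffunE add0r.
Qed.

End Solver.

Variables (ZI ZO n : nat).
Hypothesis CE : (ZI + R + ZO = C)%N.
Hypothesis R_gt0 : (0 < R)%N.

(* Entry (0, k) of the secret is the hash key rho_k; entry (i + 1, k) is the
   value at rho_k of the polynomial with coefficients the i-th message row. *)
Notation sbit := ('I_R.+1 * 'I_C.+1 * symb)%type.
Notation slot := ('I_l + sbit * 'I_C.+1)%type.

Variable (pos : slot * 'I_C -> 'I_n).
Hypothesis pos_inj : injective pos.

(** A symbol of L occupies C positions of each packet, one per coordinate over F; positions outside
    the image of [pos] carry 0. *)
Definition spread r (X : slot -> 'cV[L]_r) : 'M[F]_(r, n) :=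
  \matrix_(k, p) if [pick jb | pos jb == p] is Some jb then crd (X jb.1 k 0) 0 jb.2 else 0.

(** Reading a slot is a right multiplication, hence it commutes with [A] and is additive in [Z]. *)
Definition gather (j : slot) : 'cV[L]_n :=
  \col_p \sum_b (pos (j, b) == p)%:R * theta b.

Lemma gatherE r (Y : 'M[F]_(r, n)) j k :
  (Y^i *m gather j) k 0 = \sum_b iota (Y k (pos (j, b))) * theta b.
Proof.
rewrite mxE; under eq_bigr do rewrite !mxE mulr_sumr.
rewrite exchange_big; apply: eq_bigr => b _.
rewrite (bigD1 (pos (j, b))) //= big1 => [|p neq_p].
  by rewrite eqxx mul1r addr0.
by rewrite eq_sym (negPf neq_p) mul0r mulr0.
Qed.

Lemma spreadE r (X : slot -> 'cV[L]_r) k j b :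
  spread X k (pos (j, b)) = crd (X j k 0) 0 b.
Proof.
rewrite mxE; case: pickP => [jb /eqP/pos_inj -> //|/(_ (j, b))].
by rewrite eqxx.
Qed.

Lemma gather_spread r (X : slot -> 'cV[L]_r) j : (spread X)^i *m gather j = X j.
Proof.
apply/colP => k; rewrite gatherE -[RHS]crdK.
by apply: eq_bigr => b _; rewrite spreadE.
Qed.

Lemma mulmx_spread r r' (B : 'M[F]_(r', r)) (X : slot -> 'cV[L]_r) :
  B *m spread X = spread (fun j => B^i *m X j).
Proof.
apply/matrixP => k p; rewrite !mxE; under eq_bigr do rewrite mxE.
case: pickP => [jb _|_]; last by rewrite big1 // => i _; rewrite mulr0.
rewrite mxE; under [in RHS]eq_bigr do rewrite mxE.
by rewrite (crd_comb crdK combK) summxE; apply: eq_bigr => i _; rewrite mxE.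
Qed.

Definition msgt : finType := 'M[L]_(R, l).
Definition coin : finType :=
  ({ffun slot -> 'cV[L]_ZI} * ('rV[L]_C.+1 * {ffun sbit -> 'M[L]_(C, C.+1)}))%type.

Definition secret (S : msgt) (rho : 'rV[L]_C.+1) (i : 'I_R.+1) (k : 'I_C.+1) : L :=
  if unlift ord0 i is Some r then hash (row r S) rho 0 k else rho 0 k.

Definition secret_bit S rho (x : sbit) : bool :=
  bits (secret S rho x.1.1 x.1.2) x.2.

Definition T2 : 'M[L]_(C, ZI) := lsubmx (moore (ZI + R)).
Definition T3 : 'M[L]_(C, R) := rsubmx (moore (ZI + R)).

Definition payload (S : msgt) rho (K : {ffun sbit -> 'M[L]_(C, C.+1)}) (j : slot) :
    'cV[L]_C :=
  match j with
  | inl a => T3 *m col a S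
  | inr (x, c) => if secret_bit S rho x then col c (K x) else 0
  end.

(* [w.1] masks everything that Calvin may see; [K x] hides behind it a bit 1. *)
Definition symbols (S : msgt) (w : coin) (j : slot) : 'cV[L]_C :=
  T2 *m w.1 j + payload S w.2.1 w.2.2 j.

Definition packets S w : 'M[F]_(C, n) := spread (symbols S w).

Definition main_part (Y : 'M[F]_(C, n)) : 'M[L]_(C, l) :=
  \matrix_(k, a) (Y^i *m gather (inl a)) k 0.
Definition bit_part (Y : 'M[F]_(C, n)) (x : sbit) : 'M[L]_(C, C.+1) :=
  \matrix_(k, c) (Y^i *m gather (inr (x, c))) k 0.

(* The set counts the dimension of F^C modulo the F-rational points of the column
   space: at most ZI for a bit 1, by [not_reach_rank], more for a bit 0, by
   [bit0_flags]. *)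
Definition dec_bit Y x : bool := (#|[set k | flag (bit_part Y x) k]| <= ZI)%N.

Definition dec_secret Y (i : 'I_R.+1) (k : 'I_C.+1) : L :=
  unbits [ffun b => dec_bit Y (i, k, b)].

Definition decode (Y : 'M[F]_(C, n)) : msgt :=
  \matrix_(i, a) solve (main_part Y) (\row_k dec_secret Y ord0 k)
                       (\row_k dec_secret Y (lift ord0 i) k) 0 a.

Lemma T2E : T2 = moore ZI.
Proof. by apply/matrixP => k j; rewrite !mxE. Qed.

(** The deterministic half of the analysis. Chance enters only through the last two hypotheses, on
    the bits 1 and on the hash; bits 0 are always read correctly. *)
Lemma decode_ok A S w (Z : 'M[F]_(C, n)) t (B : 'M[F]_(t, C)) :
  let Y := A *m packets S w + Z in
  A \in unitmx -> (\rank Z <= ZO)%N -> (t <= ZI)%N ->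
  (forall x, secret_bit S w.2.1 x ->
     forall tau : 'rV[L]_C, tau *m bit_part Y x = 0 -> (tau <= B^i)%MS) ->
  (forall i (u : 'rV[L]_C),
     hash (u *m main_part Y) w.2.1 = hash (row i S) w.2.1 ->
     u *m main_part Y = row i S) ->
  decode Y = S.
Proof.
move=> Y A_unit rankZ le_t good_bits good_hash.
have YE j : Y^i *m gather j = A^i *m symbols S w j + Z^i *m gather j.
  by rewrite map_mxD mulmxDl map_mxM -mulmxA gather_spread.
have bitE x : dec_bit Y x = secret_bit S w.2.1 x.
  rewrite /dec_bit; case sx: (secret_bit _ _ _).
    apply: leq_trans le_t; apply: (@not_reach_rank _ _ iota _ _ (bit_part Y x)).
      by move=> k; rewrite inE => /flag_reach.
    exact: good_bits.
  apply/negbTE; rewrite -ltnNge.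
  pose M := \matrix_(k < ZI, c < C.+1) w.1 (inr (x, c)) k 0.
  pose E := \matrix_(p < n, c < C.+1) gather (inr (x, c)) p 0.
  have partE : bit_part Y x = A^i *m (moore ZI *m M) + Z^i *m E.
    apply: eq_cols => c; rewrite [RHS]colE mulmxDl -!mulmxA -!colE -T2E.
    have -> : col c M = w.1 (inr (x, c)) by apply/colP => k; rewrite !mxE.
    have -> : col c E = gather (inr (x, c)) by apply/colP => k; rewrite !mxE.
    have -> : col c (bit_part Y x) = Y^i *m gather (inr (x, c)).
      by apply/colP => k; rewrite 2![LHS]mxE.
    by rewrite YE /symbols /= sx addr0.
  apply: (bit0_flags crdK combK CE R_gt0 A_unit rankZ (M := M) (E := E)).
  by move=> k; rewrite inE -partE => /flag_reach.
have secE i k : dec_secret Y i k = secret S w.2.1 i k.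
  by rewrite -[RHS]bitsK; congr unbits; apply/ffunP => b; rewrite ffunE bitE.
apply/row_matrixP => i.
have -> : row i (decode Y) = solve (main_part Y) w.2.1 (hash (row i S) w.2.1).
  apply/rowP => a; rewrite [LHS]mxE [LHS]mxE; congr (solve _ _ _ 0 a).
    by apply/rowP => k; rewrite mxE secE /secret unlift_none.
  by apply/rowP => k; rewrite mxE secE /secret liftK.
have [U [UA UZ]] := decoding_rows combK CE A_unit rankZ.
pose M := \matrix_(k < ZI, a < l) w.1 (inl a) k 0.
have UY : U *m main_part Y = col_mx M S.
  rewrite -[RHS]mul1mx -UA; apply: eq_cols => a.
  rewrite !colE -!mulmxA -!colE.
  have -> : col a (main_part Y) = Y^i *m gather (inl a).
    by apply/colP => k; rewrite 2![LHS]mxE.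
  rewrite YE mulmxDr [U *m (Z^i *m _)]mulmxA UZ mul0mx addr0; congr (_ *m (_ *m _)).
  rewrite col_col_mx -[moore _]hsubmxK mul_row_col; congr (_ *m _ + _).
  by apply/colP => k; rewrite !mxE.
(* Row ZI + i of [U *m main_part Y] is row [i] of [S], so the search has a solution; [good_hash]
   makes it the right one. *)
have [|u hash_u ->] := @solveP (main_part Y) w.2.1 (hash (row i S) w.2.1).
  by exists (row (rshift ZI i) U); rewrite -row_mul UY rowKd.
exact: good_hash.
Qed.

(** * Circuits for field arithmetic, encoding and decoding *)

Section Circuits.

Variables (D : Type) (inp : D -> seq bool) (n0 : nat).
Hypothesis size_inp : forall d, size (inp d) = n0.
Variable M : nat.
Hypothesis M_ge4 : (4 <= M)%N.
Hypothesis symb_le : (#|{: symb * symb}| <= M)%N.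

Local Notation has_wire := (has_wire inp n0).
Local Notation feasible := (feasible M).

Definition known gs (v : D -> L) := vec_wires inp n0 gs (fun d => bits (v d)).

Lemma mono_known v : mono (fun gs => known gs v).
Proof. exact: mono_vec. Qed.

Lemma eq_known gs v v' : v =1 v' -> known gs v -> known gs v'.
Proof. by move=> eq_v; apply: eq_vec_wires => // d; rewrite eq_v. Qed.

Lemma symb_le1 : (#|{: symb}| <= M)%N.
Proof.
by apply: leq_trans symb_le; rewrite [X in (_ <= X)%N]card_prod; case: #|_| => // k;
   rewrite leq_pmulr.
Qed.

Lemma known_const gs x : feasible 1 gs (fun gs' => known gs' (fun=> x)).
Proof.
apply: feasible_all => // [|b|b gs1 _]; [exact: symb_le1 | exact: mono_has |].
exact: feasible_const.
Qed.

(** Schoolbook product in the basis [beta], with the structure constants hardwired into the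
    gates. *)
Lemma known_mul gs u v : known gs u -> known gs v ->
  feasible 4 gs (fun gs' => known gs' (fun d => u d * v d)).
Proof.
move=> gsu gsv; apply: feasible_all => // [|c|c gs1 ext1].
- exact: symb_le1.
- exact: mono_has.
pose f (p : symb * symb) d := bits (beta p.1 * beta p.2) c && (bits (u d) p.1 && bits (v d) p.2).
apply: (@feasible_bind _ _ 1 2 _ (fun gs' => forall p, has_wire gs' (f p))) => //.
  apply: feasible_all => // [p|p gs2 ext2]; first exact: mono_has.
  apply: (feasible_op size_inp M (fun x y => bits (beta p.1 * beta p.2) c && (x && y))).
    exact: mono_has (extends_trans ext1 ext2) (gsu p.1).
  exact: mono_has (extends_trans ext1 ext2) (gsv p.2).
move=> gs2 ext2 H2; have := feasible_big size_inp M_ge4 addb false symb_le H2.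
apply: feasible_imp => gs3; apply: eq_has_wire => d.
rewrite [in RHS](beta_sum (u d)) [in RHS](beta_sum (v d)) mulr_suml.
under [in RHS]eq_bigr do rewrite mulr_sumr.
rewrite pair_big (big_morph bits bitsD bits0) sum_ffunE; apply: eq_bigr => -[a b] _.
by rewrite /f /=; case: (bits (u d) a); case: (bits (v d) b);
   rewrite ?mul0r ?mulr0 ?bits0 ?ffunE ?andbT ?andbF.
Qed.

Lemma known_sum (I : finType) gs (f : I -> D -> L) : (#|I| <= M)%N ->
  (forall i, known gs (f i)) ->
  feasible 3 gs (fun gs' => known gs' (fun d => \sum_i f i d)).
Proof.
move=> leI gsf; apply: feasible_all => // [|c|c gs1 ext1].
- exact: symb_le1.
- exact: mono_has.
have gs1f i : has_wire gs1 (fun d => bits (f i d) c) by apply: mono_has ext1 (gsf i c).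
have := feasible_big size_inp M_ge4 addb false leI gs1f.
apply: feasible_imp => gs2; apply: eq_has_wire => d.
by rewrite (big_morph bits bitsD bits0) sum_ffunE.
Qed.

Lemma known_add gs u v : known gs u -> known gs v ->
  feasible 1 gs (fun gs' => known gs' (fun d => u d + v d)).
Proof.
move=> gsu gsv; apply: feasible_all => // [|c|c gs1 ext1].
- exact: symb_le1.
- exact: mono_has.
have := feasible_op size_inp M addb (mono_has size_inp ext1 (gsu c)) (mono_has size_inp ext1 (gsv c)).
by apply: feasible_imp => gs2; apply: eq_has_wire => d; rewrite bitsD ffunE.
Qed.

Lemma known_mask gs c v : has_wire gs c -> known gs v ->
  feasible 1 gs (fun gs' => known gs' (fun d => if c d then v d else 0)).
Proof.
move=> gsc gsv; apply: feasible_all => // [|b|b gs1 ext1].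
- exact: symb_le1.
- exact: mono_has.
have := feasible_op size_inp M andb (mono_has size_inp ext1 gsc) (mono_has size_inp ext1 (gsv b)).
by apply: feasible_imp => gs2; apply: eq_has_wire => d; case: (c d); rewrite ?bits0 ?ffunE.
Qed.

Lemma known_scale gs x v : known gs v ->
  feasible 5 gs (fun gs' => known gs' (fun d => x * v d)).
Proof.
move=> gsv; apply: (feasible_bind M_ge4 (e := 1) (e' := 4) (known_const gs x)).
by move=> gs1 ext1 H1; apply: known_mul H1 (mono_known ext1 gsv).
Qed.

Lemma known_linear (I : finType) gs (a : I -> L) (v : I -> D -> L) :
  (#|I| <= M)%N -> (forall i, known gs (v i)) ->
  feasible 7 gs (fun gs' => known gs' (fun d => \sum_i a i * v i d)).
Proof.
move=> leI gsv.
apply: (@feasible_bind _ _ 6 3 _ (fun gs' => forall i, known gs' (fun d => a i * v i d))) => //.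
  apply: feasible_all => // [i|i gs1 ext1]; first exact: mono_known.
  exact: known_scale (mono_known ext1 (gsv i)).
by move=> gs1 ext1 H1; apply: (known_sum (f := fun i d => a i * v i d)).
Qed.

Lemma known_exp gs v a : (a <= M)%N -> known gs v ->
  feasible 6 gs (fun gs' => known gs' (fun d => v d ^+ a)).
Proof.
move=> leaM gsv; apply: (feasible_bind M_ge4 (e := 1) (e' := 5) (known_const gs 1)).
move=> gs1 ext1 H1.
apply: (@feasible_iter _ 4 a gs1 (fun j gs' => known gs' (fun d => v d ^+ j))) => //.
move=> j gs2 ltj ext2 Hj.
have := known_mul (mono_known (extends_trans ext1 ext2) gsv) Hj.
by apply: feasible_imp => gs3; apply: eq_known => d; rewrite exprS.
Qed.

Hypothesis l_le : (l <= M)%N.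
Hypothesis C_le : (C.+1 <= M)%N.

Lemma known_hash gs (w : D -> 'rV[L]_l) (rho : D -> 'rV[L]_C.+1) k :
  (forall a, known gs (fun d => w d 0 a)) -> known gs (fun d => rho d 0 k) ->
  feasible 9 gs (fun gs' => known gs' (fun d => hash (w d) (rho d) 0 k)).
Proof.
move=> gsw gsr.
apply: (@feasible_bind _ _ 8 3 _ (fun gs' => forall a : 'I_l,
    known gs' (fun d => w d 0 a * rho d 0 k ^+ a))) => //.
  apply: feasible_all => // [|a|a gs1 ext1]; first by rewrite card_ord.
    exact: mono_known.
  have lea : (a <= M)%N by apply: leq_trans (ltnW (ltn_ord a)) l_le.
  apply: (feasible_bind M_ge4 (e := 6) (e' := 4) (known_exp lea (mono_known ext1 gsr))).
  move=> gs2 ext2 H2; apply: known_mul H2.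
  exact: mono_known (extends_trans ext1 ext2) (gsw a).
move=> gs1 ext1 H1.
have leI : (#|'I_l| <= M)%N by rewrite card_ord.
have := known_sum leI H1; apply: feasible_imp => gs2.
by apply: eq_known => d; rewrite mxE.
Qed.

Hypothesis slot_le : (#|{: slot}| <= M)%N.

Lemma R_le_C : (R <= C)%N.
Proof. by rewrite -CE addnAC addnC leq_addr. Qed.

Lemma ZI_le_C : (ZI <= C)%N.
Proof. by rewrite -CE -addnA leq_addr. Qed.

Lemma ord_le t : (t <= C.+1)%N -> (#|'I_t| <= M)%N.
Proof. by rewrite card_ord => /leq_trans; apply. Qed.

Lemma known_symbols gs (S : D -> msgt) (w : D -> coin) :
  (forall i a, known gs (fun d => S d i a)) ->
  (forall j i, known gs (fun d => (w d).1 j i 0)) ->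
  (forall k, known gs (fun d => (w d).2.1 0 k)) ->
  (forall x k c, known gs (fun d => (w d).2.2 x k c)) ->
  feasible 12 gs (fun gs' => forall j k, known gs' (fun d => symbols (S d) (w d) j k 0)).
Proof.
move=> gsS gsw gsr gsK.
apply: (@feasible_bind _ _ 11 11 _ (fun gs' => forall i k,
    known gs' (fun d => secret (S d) (w d).2.1 i k))) => //.
  apply: feasible_all => // [|i|i gs1 ext1]; first by apply: ord_le; rewrite ltnS R_le_C.
    by apply: mono_all => k; apply: mono_known.
  apply: feasible_all => // [|k|k gs2 ext2]; first exact: ord_le.
    exact: mono_known.
  have ext := extends_trans ext1 ext2; rewrite /secret.
  case: unliftP => [r _|_]; last exact/feasible_ret/(mono_known ext).
  apply: known_hash => [a|]; last exact: mono_known ext (gsr k).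
  by apply: eq_known (mono_known ext (gsS r a)) => d; rewrite mxE.
move=> gs1 ext1 H1; apply: feasible_all => // [j|j gs2 ext2].
  by apply: mono_all => k; apply: mono_known.
apply: feasible_all => // [|k|k gs3 ext3]; first exact: ord_le.
  exact: mono_known.
have ext13 := extends_trans ext2 ext3; have ext := extends_trans ext1 ext13.
apply: (@feasible_bind _ _ 7 8 _ (fun gs' =>
    known gs' (fun d => \sum_i T2 k i * (w d).1 j i 0))) => //.
  have gsw3 i : known gs3 (fun d => (w d).1 j i 0) by apply: mono_known ext _.
  have := known_linear (T2 k) (ord_le (leqW ZI_le_C)) gsw3.
  by apply: feasible_imp => gs4; apply: eq_known => d.
move=> gs4 ext4 H4; apply: (@feasible_bind _ _ 7 1 _ (fun gs' =>
    known gs' (fun d => payload (S d) (w d).2.1 (w d).2.2 j k 0))) => //.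
  have ext' := extends_trans ext ext4; case: j {H4} => [a|[x c]] /=.
    have gsSa i : known gs4 (fun d => S d i a) by apply: mono_known ext' _.
    have := known_linear (T3 k) (ord_le (leqW R_le_C)) gsSa.
    apply: feasible_imp => gs5; apply: eq_known => d; rewrite mxE.
    by apply: eq_bigr => i _; rewrite [col _ _ _ _]mxE.
  apply: feasible_le (_ : 1 <= 7)%N _ => //.
  have gsx : has_wire gs4 (fun d => secret_bit (S d) (w d).2.1 x).
    exact: mono_known (extends_trans ext13 ext4) (H1 x.1.1 x.1.2) x.2.
  have := known_mask gsx (mono_known ext' (gsK x k c)).
  apply: feasible_imp => gs5; apply: eq_known => d.
  by case: ifP => _; rewrite mxE.
move=> gs5 ext5 H5; have := known_add (mono_known ext5 H4) H5.
by apply: feasible_imp => gs6; apply: eq_known => d; rewrite [RHS]mxE [in RHS]mxE.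
Qed.

Lemma wires_packets gs (S : D -> msgt) (w : D -> coin) :
  (forall i a, known gs (fun d => S d i a)) ->
  (forall j i, known gs (fun d => (w d).1 j i 0)) ->
  (forall k, known gs (fun d => (w d).2.1 0 k)) ->
  (forall x k c, known gs (fun d => (w d).2.2 x k c)) ->
  feasible 13 gs (fun gs' => forall (kpi : 'I_C * 'I_n * 'I_m),
    has_wire gs' (fun d => fb (packets (S d) (w d) kpi.1.1 kpi.1.2) kpi.2)).
Proof.
move=> gsS gsw gsr gsK.
apply: (feasible_bind M_ge4 (e := 12) (e' := 0) (known_symbols gsS gsw gsr gsK)).
move=> gs1 ext1 H1; have [gs2 [ext2 sz2 H2]] := feasible_const size_inp M false gs1.
exists gs2; split=> // -[[k p] i] /=.
have [[j b] pos_p | no_p] := pickP (fun jb => pos jb == p); last first.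
  apply: eq_has_wire H2 => d; rewrite mxE; case: pickP => [jb|_].
    by rewrite no_p.
  by rewrite fb0 ffunE.
apply: eq_has_wire (mono_known ext2 (H1 j k) (b, i)) => d.
by rewrite -(eqP pos_p) spreadE bitsE.
Qed.

Hypothesis coord_le : (#|{: 'I_C.+1 * symb + 'I_l * symb}| <= M)%N.
Hypothesis gens_le : (#|{: 'I_C.+1 * symb + 'I_C * 'I_m}| <= M)%N.
Hypothesis exp_le : (4 * 2 ^ C <= M)%N.

Lemma Csymb_le : (#|{: 'I_C * symb}| <= M)%N.
Proof.
apply: leq_trans gens_le; rewrite card_sum; apply: leq_trans (leq_addr _ _).
by rewrite !card_prod !card_ord leq_mul2r leqnSn orbT.
Qed.

Lemma known_vbits gs (v : D -> 'cV[L]_C) : (forall i, known gs (fun d => v d i 0)) ->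
  vec_wires inp n0 gs (fun d => vbits (v d)).
Proof.
by move=> gsv [i b]; apply: eq_has_wire (gsv i b) => d; rewrite ffunE.
Qed.

Lemma wire_flag gs (Y : D -> 'M[L]_(C, C.+1)) k :
  (forall i c, known gs (fun d => Y d i c)) ->
  feasible 9 gs (has_wire^~ (fun d => flag (Y d) k)).
Proof.
move=> gsY; apply: (@feasible_bind _ _ 7 8 _ (fun gs' => forall r i,
    known gs' (fun d => flag_gen (Y d) k r i 0))) => //.
  apply: feasible_all => // [r|r gs1 ext1]; first by apply: mono_all => i; apply: mono_known.
  apply: feasible_all => // [|i|i gs2 ext2]; first exact/ord_le/leqnSn.
    exact: mono_known.
  case: r => [[c b]|[i' a]] /=.
    have := known_scale (beta b) (mono_known (extends_trans ext1 ext2) (gsY i c)).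
    by apply: feasible_imp => gs3; apply: eq_known => d; rewrite !mxE.
  apply: feasible_le (_ : 1 <= 5)%N _ => //; exact: known_const.
move=> gs1 ext1 H1; apply: (@feasible_bind _ _ 2 7 _ (fun gs' => forall i,
    known gs' (fun=> (delta_mx k 0 : 'cV[L]_C) i 0))) => //.
  apply: feasible_all => // [|i|i gs2 ext2]; first exact/ord_le/leqnSn.
    exact: mono_known.
  exact: known_const.
move=> gs2 ext2 H2; apply: (@feasible_bind _ _ 6 2 _ (fun gs' =>
    vec_wires inp n0 gs' (fun d => flag_red (Y d) k))) => //.
  apply: (feasible_red size_inp M_ge4 Csymb_le _ (K := _) (ks := enum _)
     (row := fun r d => vbits (flag_gen (Y d) k r)) (t := fun=> vbits (delta_mx k 0))).
  - by rewrite -cardE Csymb_le.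
  - exact: gens_le.
  - by rewrite -cardE gens_le.
  - by move=> r; apply: known_vbits => i; apply: mono_known ext2 (H1 r i).
  - exact: known_vbits.
move=> gs3 ext3 H3; have := feasible_big size_inp M_ge4 orb false Csymb_le H3.
by apply: feasible_imp => gs4; apply: eq_has_wire => d; rewrite big_orE.
Qed.

Section Decoder.

Variables (gs0 : seq gate) (Y : D -> 'M[F]_(C, n)).
Hypothesis gsY : forall k p i, has_wire gs0 (fun d => fb (Y d k p) i).

Lemma known_gather gs j k : extends gs0 gs ->
  known gs (fun d => ((Y d)^i *m gather j) k 0).
Proof.
move=> ext [b i]; apply: (mono_has size_inp ext).
apply: eq_has_wire (gsY k (pos (j, b)) i) => d.
rewrite bitsE gatherE /=.
rewrite (_ : \sum__ _ = \sum_b iota ((\row_b Y d k (pos (j, b))) 0 b) * theta b).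
  by rewrite combK mxE.
by apply: eq_bigr => c _; rewrite mxE.
Qed.

Lemma wire_dec_bits :
  feasible 12 gs0 (fun gs' => forall x, has_wire gs' (fun d => dec_bit (Y d) x)).
Proof.
apply: feasible_all => // [|x|x gs1 ext1].
- apply: leq_trans slot_le; rewrite card_sum; apply: leq_trans (leq_addl _ _).
  by rewrite [X in (_ <= X)%N]card_prod leq_pmulr // card_ord.
- exact: mono_has.
apply: (@feasible_bind _ _ 10 1 _ (fun gs' => forall k,
    has_wire gs' (fun d => flag (bit_part (Y d) x) k))) => //.
  apply: feasible_all => // [|k|k gs2 ext2]; first exact/ord_le/leqnSn.
    exact: mono_has.
  apply: wire_flag => i c.
  have := known_gather (inr (x, c)) i (extends_trans ext1 ext2).
  by apply: eq_known => d; rewrite [RHS]mxE.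
(* The threshold on the number of flags is a truth table on C bits, of size independent of n. *)
move=> gs2 ext2 H2; apply: can_le (_ : 4 * 2 ^ size (enum 'I_C) <= _)%N _.
  by rewrite -cardE card_ord.
have := can_fun size_inp (enum 'I_C) (fun s => count id s <= ZI)%N H2.
apply: can_imp => gs3; apply: eq_has_wire => d; rewrite /dec_bit count_map.
rewrite -sum1_count -sum1_card big_enum_cond /=; congr (_ <= _)%N.
by apply: eq_bigl => k; rewrite inE.
Qed.

Lemma wires_decode : feasible 15 gs0 (fun gs' =>
  forall iab : 'I_R * 'I_l * symb,
    has_wire gs' (fun d => bits (decode (Y d) iab.1.1 iab.1.2) iab.2)).
Proof.
apply: (feasible_bind M_ge4 (e := 12) (e' := 14) wire_dec_bits) => gs1 ext1 H1.
have gs1_secret i k : known gs1 (fun d => dec_secret (Y d) i k).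
  by move=> b; apply: eq_has_wire (H1 (i, k, b)) => d; rewrite unbitsK ffunE.
suffices: feasible 14 gs1 (fun gs' => forall i : 'I_R, vec_wires inp n0 gs' (fun d =>
    solve_red (main_part (Y d)) (\row_k dec_secret (Y d) ord0 k)
              (\row_k dec_secret (Y d) (lift ord0 i) k))).
  apply: feasible_imp => gs2 H2 [[i a] b] /=; apply: eq_has_wire (H2 i (inr (a, b))) => d.
  by rewrite !mxE unbitsK ffunE.
apply: feasible_all => // [|i|i gs2 ext2]; first exact/ord_le/leqW/R_le_C.
  exact: mono_vec.
have ext02 := extends_trans ext1 ext2.
apply: (@feasible_bind _ _ 12 7 _ (fun gs' =>
    (forall r a, known gs' (fun d => solve_gen (main_part (Y d)) r 0 a)) /\
    (forall r k, known gs' (fun d => hash (solve_gen (main_part (Y d)) r)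
                                       (\row_k dec_secret (Y d) ord0 k) 0 k)))) => //.
  apply: (@feasible_bind _ _ 7 11 _ (fun gs' =>
    forall r a, known gs' (fun d => solve_gen (main_part (Y d)) r 0 a))) => //.
    apply: feasible_all => // [|r|r gs3 ext3]; first exact: Csymb_le.
      by apply: mono_all => a; apply: mono_known.
    apply: feasible_all => // [|a|a gs4 ext4]; first by rewrite card_ord.
      exact: mono_known.
    have ext := extends_trans ext02 (extends_trans ext3 ext4).
    have := known_scale (beta r.2) (known_gather (inl a) r.1 ext).
    by apply: feasible_imp => gs5; apply: eq_known => d; rewrite 3![in RHS]mxE.
  move=> gs3 ext3 H3.
  suffices: feasible 11 gs3 (fun gs' => forall r k,
      known gs' (fun d => hash (solve_gen (main_part (Y d)) r)
                            (\row_k dec_secret (Y d) ord0 k) 0 k)).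
    case=> gs4 [ext4 sz4 H4]; exists gs4; split=> //; split=> // r a.
    exact: mono_known ext4 (H3 r a).
  apply: feasible_all => // [|r|r gs4 ext4]; first exact: Csymb_le.
    by apply: mono_all => k; apply: mono_known.
  apply: feasible_all => // [|k|k gs5 ext5]; first exact: ord_le.
    exact: mono_known.
  have ext35 := extends_trans ext4 ext5.
  apply: known_hash => [a|]; first exact: mono_known ext35 (H3 r a).
  have := mono_known (extends_trans ext2 (extends_trans ext3 ext35)) (gs1_secret ord0 k).
  by apply: eq_known => d; rewrite mxE.
move=> gs3 ext3 [H3 H3']; apply: (@feasible_bind _ _ 1 6 _ (fun gs' =>
   vec_wires inp n0 gs' (fun d => tagged_row (\row_k dec_secret (Y d) (lift ord0 i) k) 0))) => //.
  have [gs4 [ext4 sz4 H4]] := known_const gs3 0; exists gs4; split=> // -[[k b]|[a b]].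
    have := mono_known (extends_trans ext2 (extends_trans ext3 ext4)) (gs1_secret (lift ord0 i) k).
    by move/(_ b); apply: eq_has_wire => d; rewrite [RHS]ffunE mxE.
  by apply: eq_has_wire (H4 b) => d; rewrite [RHS]ffunE mxE.
move=> gs4 ext4 H4.
apply: (feasible_red size_inp M_ge4 coord_le _ (K := _) (ks := enum _)
   (row := fun r d => tagged_row (hash (solve_gen (main_part (Y d)) r)
     (\row_k dec_secret (Y d) ord0 k)) (solve_gen (main_part (Y d)) r))).
- rewrite size_map -cardE; apply: leq_trans coord_le.
  by rewrite [X in (_ <= X)%N]card_sum leq_addr.
- exact: Csymb_le.
- by rewrite -cardE Csymb_le.
- move=> r [[k b]|[a b]].
    apply: eq_has_wire (mono_known ext4 (H3' r k) b) => d; by rewrite [RHS]ffunE.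
  apply: eq_has_wire (mono_known ext4 (H3 r a) b) => d; by rewrite [RHS]ffunE.
- exact: H4.
Qed.

End Decoder.

End Circuits.

(** * Calvin's view and the count of bad coins *)

Section Observation.

Variable B1 : 'M[F]_(ZI, C).
Hypothesis B1_free : row_free B1.

Lemma B1T2_unit : B1^i *m T2 \in unitmx.
Proof. by rewrite T2E; apply: moore_unit B1_free; apply: theta_free combK. Qed.

(* The coins that make Calvin observe [V]. *)
Definition mask_of S (rK : 'rV[L]_C.+1 * {ffun sbit -> 'M[L]_(C, C.+1)})
    (V : {ffun slot -> 'cV[L]_ZI}) : {ffun slot -> 'cV[L]_ZI} :=
  [ffun j => invmx (B1^i *m T2) *m (V j - B1^i *m payload S rK.1 rK.2 j)].

Lemma observe_mask S rK V j : B1^i *m symbols S (mask_of S rK V, rK) j = V j.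
Proof.
rewrite /symbols /= ffunE mulmxDr !mulmxA -mulmxA mulKVmx ?B1T2_unit //.
by rewrite subrK.
Qed.

Lemma mask_of_bij S rK : bijective (mask_of S rK).
Proof.
exists (fun W : {ffun slot -> 'cV[L]_ZI} => [ffun j => B1^i *m (T2 *m W j + payload S rK.1 rK.2 j)]) => V.
  apply/ffunP => j; rewrite ffunE; have := observe_mask S rK V j.
  by rewrite /symbols.
apply/ffunP => j; rewrite !ffunE mulmxDr addrK mulmxA mulKmx ?B1T2_unit //.
Qed.

Lemma observe_packets S rK V : B1 *m packets S (mask_of S rK V, rK) = spread V.
Proof.
rewrite mulmx_spread; apply/matrixP => k p; rewrite !mxE.
by case: pickP => // jb _; rewrite observe_mask.
Qed.

(** The bijection depends on [S] and [rK], but [V] ranges over the same set for all of them. So [V],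
    which determines Calvin's view, is uniform and independent of the message, the key and the
    random matrices. *)
Lemma reindex_coin (T : nmodType) (S : msgt) (f : coin -> T) :
  \sum_w f w = \sum_V \sum_rK f (mask_of S rK V, rK).
Proof.
rewrite (eq_bigr (fun w => f (w.1, w.2))); last by case.
rewrite -(pair_bigA _ (fun V rK => f (V, rK))) exchange_big [RHS]exchange_big /=.
apply: eq_bigr => rK _; rewrite (reindex (mask_of S rK)) //.
exact/onW_bij/mask_of_bij.
Qed.

Section Bad.

Variables (A : 'M[F]_C) (Z : 'M[F]_(C, n)) (V : {ffun slot -> 'cV[L]_ZI}).
Hypotheses (A_unit : A \in unitmx) (rankZ : (\rank Z <= ZO)%N).

Notation coins2 := ('rV[L]_C.+1 * {ffun sbit -> 'M[L]_(C, C.+1)})%type.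

Definition received (S : msgt) (rK : coins2) := A *m packets S (mask_of S rK V, rK) + Z.

Lemma received_gather S rK j :
  (received S rK)^i *m gather j =
  A^i *m (T2 *m mask_of S rK V j + payload S rK.1 rK.2 j) + Z^i *m gather j.
Proof. by rewrite map_mxD mulmxDl map_mxM -mulmxA gather_spread. Qed.

(** With w y = 1, adding y h to [K x] shifts [w *m K x] by h, so the |L|^(C+1) translates of the set
    counted are disjoint. *)
Lemma count_row (v : 'rV[L]_C.+1) (x : sbit) (w : 'rV[L]_C) : w != 0 ->
  (#|L| ^ C.+1 * #|[pred K : {ffun sbit -> 'M[L]_(C, C.+1)} | w *m K x == v]| <=
   #|{: {ffun sbit -> 'M[L]_(C, C.+1)}}|)%N.
Proof.
move=> nz_w; set P := [pred K | _].
have [y wy] : exists y : 'cV[L]_C, w *m y = 1%:M.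
  by exists (pinvmx w); apply: mulmxVp; rewrite /row_free rank_rV nz_w.
pose sh (p : 'rV[L]_C.+1 * {ffun sbit -> 'M[L]_(C, C.+1)}) :=
  [ffun z => if z == x then p.2 z + y *m p.1 else p.2 z].
have <- : #|[pred p : 'rV[L]_C.+1 * {ffun sbit -> 'M[L]_(C, C.+1)} | P p.2]| =
          (#|L| ^ C.+1 * #|P|)%N.
  have <- : #|{: 'rV[L]_C.+1}| = (#|L| ^ C.+1)%N by rewrite card_mx mul1n.
  by rewrite -cardX; apply: eq_card => -[h K]; rewrite !inE.
apply: (@leq_card_in _ _ sh) => -[h K] [h' K']; rewrite !inE /= => /eqP Kx /eqP K'x.
move=> /ffunP eq_sh.
have eq_h : h = h'.
  have := congr1 (mulmx w) (eq_sh x); rewrite !ffunE eqxx !mulmxDr Kx K'x !mulmxA wy !mul1mx.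
  by move/addrI.
rewrite eq_h; congr (_, _); apply/ffunP => z; have := eq_sh z; rewrite !ffunE eq_h.
by case: eqP => // _ /addIr.
Qed.

Definition bad_bit x (S : msgt) (rK : coins2) : bool :=
  secret_bit S rK.1 x &&
  [exists tau : 'rV[L]_C, (tau *m bit_part (received S rK) x == 0) &&
                          ~~ (tau <= (B1 *m invmx A)^i)%MS].

(** For [tau] outside the row span of B1 A^-1, the product of [tau] and the matrix received is an
    affine equidistributed function of [K x]. It vanishes with probability |L|^-(C+1), and there are
    |L|^C vectors [tau]. *)
Lemma bad_bit_count x :
  (#|L| * #|[pred p : msgt * coins2 | bad_bit x p.1 p.2]| <=
   #|{: msgt * coins2}|)%N.
Proof.
rewrite card_prod; apply: leq_card_pairl => S; rewrite card_prod.
apply: leq_card_pairl => rho /=.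
(* For fixed [V], what is sent on a slot is a fixed vector plus [Pi] times the payload. A row killed
   by [Pi] is a combination of the rows of [B1]. *)
pose Pi := 1%:M - T2 *m (invmx (B1^i *m T2) *m B1^i).
pose Vx := \matrix_(k, c) V (inr (x, c)) k 0.
pose cst := A^i *m (T2 *m (invmx (B1^i *m T2) *m Vx)) +
            \matrix_(k, c) (Z^i *m gather (inr (x, c))) k 0.
pose P (tau : 'rV[L]_C) := [pred K : {ffun sbit -> 'M[L]_(C, C.+1)} |
   (tau *m A^i *m Pi != 0) && (tau *m A^i *m Pi *m K x == - (tau *m cst))].
have sub : {subset [pred K | bad_bit x S (rho, K)] <= [pred K | [exists tau, P tau K]]}.
  move=> K; rewrite !inE => /andP[/= sx /existsP[tau /andP[tau0 ntau]]].
  apply/existsP; exists tau; apply/andP; split.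
    apply: contra ntau; rewrite mulmxBr mulmx1 subr_eq0 => /eqP tauA.
    rewrite -[tau](mulmxK (_ : A^i \in unitmx)) ?map_unitmx // tauA.
    rewrite map_mxM map_invmx.
    rewrite (_ : _ *m invmx A^i = (tau *m A^i *m T2 *m invmx (B1^i *m T2)) *m
               (B1^i *m invmx A^i)) ?submxMl //.
    by rewrite !mulmxA.
  have -> : tau *m A^i *m Pi *m K x = tau *m (bit_part (received S (rho, K)) x - cst).
    rewrite -!mulmxA; congr (_ *m _); apply: eq_cols => c.
    pose j : slot := inr (x, c).
    have -> : col c (bit_part (received S (rho, K)) x - cst) =
        (received S (rho, K))^i *m gather j -
        (A^i *m (T2 *m (invmx (B1^i *m T2) *m V j)) + Z^i *m gather j).
      have cV : col c Vx = V j by apply/colP => k; rewrite !mxE.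
      rewrite linearB linearD /= ![col c (_ *m _)]colE -!mulmxA -colE cV.
      by congr (_ - (_ + _)); apply/colP => k; rewrite 2![LHS]mxE.
    rewrite received_gather /= sx ffunE /= sx colE -!mulmxA -colE.
    have E (a b k : 'cV[L]_C) : (a - b + k) - a = k - b.
      by rewrite addrC !addrA addNr sub0r addrC.
    rewrite opprD addrACA subrr addr0 -mulmxBr [invmx _ *m (_ - _)]mulmxBr.
    rewrite [T2 *m (_ - _)]mulmxBr E.
    by rewrite mulmxBl mul1mx -!mulmxA.
  by rewrite mulmxBr (eqP tau0) sub0r.
apply: leq_trans (leq_mul (leqnn _) (subset_leq_card (introT subsetP sub))) _.
rewrite -(@leq_pmul2l (#|L| ^ C)) ?expn_gt0 ?(ltnW (finNzRing_gt1 L)) //.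
rewrite mulnA -expnSr.
have -> : (#|L| ^ C = #|{: 'rV[L]_C}|)%N by rewrite card_mx mul1n.
apply: leq_card_exists => tau.
have [tau0|ntau] := eqVneq (tau *m A^i *m Pi) 0.
  by rewrite (eq_card0 (A := P tau)) ?muln0 // => K; rewrite !inE tau0 eqxx.
rewrite (eq_card (B := [pred K : {ffun sbit -> 'M[L]_(C, C.+1)} | tau *m A^i *m Pi *m K x == - (tau *m cst)])).
  exact: count_row.
by move=> K; rewrite !inE ntau.
Qed.

Definition bad_row i (S : msgt) (rK : coins2) : bool :=
  [exists u : 'rV[L]_C,
     (hash (u *m main_part (received S rK)) rK.1 == hash (row i S) rK.1) &&
     (u *m main_part (received S rK) != row i S)].

(** Every entry of the key must be among the at most [l] roots of a nonzero polynomial of degree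
    below [l]. *)
Lemma hash_roots (w : 'rV[L]_l) : w != 0 ->
  (#|[pred rho : 'rV[L]_C.+1 | hash w rho == 0%R]| <= l ^ C.+1)%N.
Proof.
move=> nz_w; pose p := \sum_(a < l) w 0 a *: 'X^a.
have nz_p : p != 0.
  apply: contraNneq nz_w => p0; apply/eqP/rowP => a; rewrite mxE -(coef0 L a) -p0 coef_sum.
  rewrite (bigD1 a) //= coefZ coefXn eqxx mulr1 big1 ?addr0 // => b neq_ba.
  by rewrite coefZ coefXn val_eqE eq_sym (negPf neq_ba) mulr0.
have le_roots : (#|root p| <= l)%N.
  rewrite cardE; apply: leq_trans (ltnW (max_poly_roots nz_p _ (enum_uniq _))) _.
    by apply/allP => x; rewrite mem_enum.
  rewrite (leq_trans (size_sum _ _ _)) //; apply/bigmax_leqP => a _.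
  by rewrite (leq_trans (size_scale_leq _ _)) // size_polyXn.
apply: (@leq_trans (#|root p| ^ C.+1)); last by rewrite leq_exp2r.
have inj : injective (fun rho : 'rV[L]_C.+1 => [ffun k : 'I_C.+1 => rho 0 k]).
  by move=> rho rho' /ffunP eq_r; apply/rowP => k; have := eq_r k; rewrite !ffunE.
rewrite -[X in (_ ^ X)%N]card_ord -card_ffun_on -(card_image inj).
apply/subset_leq_card/subsetP => _ /imageP[rho h0 ->].
apply/ffun_onP => k; rewrite ffunE; apply/eqP; rewrite horner_sum.
have /eqP/rowP/(_ k) := h0; rewrite !mxE => {2}<-.
by apply: eq_bigr => a _; rewrite hornerE hornerXn.
Qed.

(** The message slots do not involve the key, so for fixed [V] the candidate rows are determined
    before the key is drawn. *)
Lemma main_indep S rK rK' : main_part (received S rK) = main_part (received S rK').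
Proof.
apply/matrixP => k a; rewrite mxE [RHS]mxE !received_gather /=.
by rewrite ![mask_of _ _ _ _]ffunE.
Qed.

Lemma bad_row_count i :
  (#|L| * #|[pred p : msgt * coins2 | bad_row i p.1 p.2]| <=
   #|{: msgt * coins2}| * l ^ C.+1)%N.
Proof.
apply: (@leq_trans (#|{: msgt}| * (#|{: coins2}| * l ^ C.+1))); last first.
  by rewrite [X in (_ <= X * _)%N]card_prod mulnA.
apply: leq_card_pairl => S; rewrite card_prod [X in (_ <= X * _)%N]mulnC -mulnA.
apply: leq_card_pairr => K /=.
(* By [main_indep] any key may be put here; 0 is a placeholder. *)
pose M0 := main_part (received S (0, K)).
pose P (u : 'rV[L]_C) := [pred rho : 'rV[L]_C.+1 |
  (u *m M0 + row i S != 0) && (hash (u *m M0 + row i S) rho == 0)].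
have sub : {subset [pred rho | bad_row i S (rho, K)] <= [pred rho | [exists u, P u rho]]}.
  move=> rho; rewrite !inE => /existsP[u /andP[/= /eqP eq_h neq]]; apply/existsP; exists u.
  have -> : M0 = main_part (received S (rho, K)) by apply: main_indep.
  rewrite /= hashD eq_h -hashD.
  have DD (v : 'rV[L]_l) : v + v = 0 by apply/rowP => a; rewrite !mxE LDD.
  rewrite DD hash0 eqxx andbT; apply: contra neq => /eqP e.
  by apply/eqP; rewrite -[LHS]addr0 -(DD (row i S)) addrA e add0r.
rewrite card_mx mul1n expnSr -mulnA mulnCA leq_mul2l; apply/orP; right.
apply: leq_trans (subset_leq_card (introT subsetP sub)) _.
rewrite -[#|_|]mul1n; have -> : (#|L| ^ C = #|{: 'rV[L]_C}|)%N by rewrite card_mx mul1n.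
apply: leq_card_exists => u; rewrite mul1n.
have [z|nz] := eqVneq (u *m M0 + row i S) 0.
  by rewrite (eq_card0 (A := P u)) // => rho; rewrite !inE z eqxx.
apply: leq_trans (hash_roots nz); apply/subset_leq_card/subsetP => rho.
by rewrite !inE => /andP[].
Qed.

Lemma bad_count :
  (#|L| * #|[pred p : msgt * coins2 | decode (received p.1 p.2) != p.1]| <=
   #|{: msgt * coins2}| * (#|{: sbit}| + R * l ^ C.+1))%N.
Proof.
pose P1 := [pred p : msgt * coins2 | [exists x, bad_bit x p.1 p.2]].
pose P2 := [pred p : msgt * coins2 | [exists i, bad_row i p.1 p.2]].
have sub : {subset [pred p : msgt * coins2 | decode (received p.1 p.2) != p.1]
              <= [predU P1 & P2]}.
  move=> [S rK]; rewrite !inE /=; apply: contraR; rewrite negb_or !negb_exists.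
  case/andP=> /forallP noP1 /forallP noP2; apply/eqP.
  apply: (@decode_ok A S (mask_of S rK V, rK) Z ZI (B1 *m invmx A)) => //.
    move=> x sx tau tau0; have := noP1 x; rewrite /bad_bit sx /= negb_exists.
    by move=> /forallP/(_ tau); rewrite tau0 eqxx /= negbK.
  move=> i u eq_h; have := noP2 i; rewrite negb_exists => /forallP/(_ u).
  by rewrite eq_h eqxx /= negbK => /eqP.
apply: (@leq_trans (#|L| * (#|P1| + #|P2|))).
  rewrite leq_mul2l; apply/orP; right.
  apply: leq_trans (subset_leq_card (introT subsetP sub)) _.
  by rewrite -cardUI leq_addr.
rewrite !mulnDr leq_add //.
  rewrite [X in (_ <= X)%N]mulnC.
  exact: (leq_card_exists (P := fun x => [pred p : msgt * coins2 | bad_bit x p.1 p.2])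
            bad_bit_count).
rewrite mulnCA -[R in (_ <= R * _)%N]card_ord.
exact: (leq_card_exists (P := fun i => [pred p : msgt * coins2 | bad_row i p.1 p.2])
          bad_row_count).
Qed.

End Bad.

End Observation.

(** * Secrecy and error probability of the code *)

Section Assembly.

Variable Rt : realType.

Notation coins2 := ('rV[L]_C.+1 * {ffun sbit -> 'M[L]_(C, C.+1)})%type.

Lemma msgt_gt0 : (0 < #|msgt|)%N.
Proof. by apply/card_gt0P; exists (0 : 'M_(R, l)). Qed.

Lemma coin_gt0 : (0 < #|coin|)%N.
Proof. by apply/card_gt0P; exists (0, (0, [ffun=> 0])). Qed.

Definition code : scheme Rt F C n :=
  @Scheme Rt F C n msgt msgt_gt0 (fun S => push Rt (packets S) coin_gt0) decode.

Lemma code_secret : perfectly_secret code ZI.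
Proof.
move=> B; have [B1 B1_free /submxP[E BE]] := row_free_sup B ZI_le_C.
pose f w : Rt := #|coin|%:R^-1 * \sum_(V : {ffun slot -> 'cV[L]_ZI}) \sum_(rK : coins2) (E *m spread V == w)%:R.
apply: (mutual_info_const (eavesdrop_law_sum1 code B) (f := f)) => s w.
congr (_ * _); rewrite /= big_mkcond /=.
transitivity (\sum_X push_mass Rt (packets s) X * (B *m X == w)%:R).
  by apply: eq_bigr => X _; case: eqP; rewrite ?mulr1 ?mulr0.
(* After the change of variables the summand no longer mentions the message. *)
rewrite sum_push_mass (reindex_coin B1_free s); congr (_ * _).
apply: eq_bigr => V _; apply: eq_bigr => rK _.
by rewrite BE -mulmxA observe_packets.
Qed.

Lemma code_error A B (calvin : strategy Rt F C n ZI) :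
  A \in unitmx -> jams_at_most ZO calvin ->
  error_prob code A B calvin <= (#|{: sbit}| + R * l ^ C.+1)%:R / #|L|%:R.
Proof.
move=> A_unit jam; set eta := _ / _.
have [B1 B1_free /submxP[E BE]] := row_free_sup B ZI_le_C.
have L_gt0 : 0 < #|L|%:R :> Rt by rewrite ltr0n ltnW // finNzRing_gt1.
have bad V Z : (\rank Z <= ZO)%N ->
    \sum_s \sum_(rK : coins2) (decode (A *m packets s (mask_of B1 s rK V, rK) + Z) != s)%:R
    <= eta * #|{: msgt * coins2}|%:R :> Rt.
  move=> rankZ; rewrite pair_bigA /= -natr_sum /eta mulrAC ler_pdivlMr // -!natrM ler_nat.
  rewrite mulnC [X in (_ <= X)%N]mulnC.
  apply: leq_trans (bad_count B1 V A_unit rankZ).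
  rewrite leq_mul2l; apply/orP; right; rewrite -sum1_card [X in (_ <= X)%N]big_mkcond /=.
  by apply: leq_sum => p _; rewrite inE; case: (_ != _).
pose h s X : Rt := \sum_(Z | decode (A *m X + Z) != s) calvin (B *m X) Z.
have -> : error_prob code A B calvin =
    #|msgt|%:R^-1 * (#|coin|%:R^-1 * \sum_s \sum_w h s (packets s w)).
  rewrite /error_prob -mulr_sumr; congr (_ * _); rewrite mulr_sumr.
  by apply: eq_bigr => s _; rewrite -(sum_push_mass (W := coin) (packets s) (h s)).
(* [calvin] now receives [E *m spread V], so the law of [Z] is free of the message, the key and the
   random matrices; these can be averaged first, for fixed [V] and [Z]. *)
have -> : \sum_s \sum_w h s (packets s w) =
  \sum_(V : {ffun slot -> 'cV[L]_ZI}) \sum_Z calvin (E *m spread V) Z *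
    \sum_s \sum_(rK : coins2) (decode (A *m packets s (mask_of B1 s rK V, rK) + Z) != s)%:R.
  under eq_bigr => s _ do rewrite (reindex_coin B1_free s).
  rewrite exchange_big; apply: eq_bigr => V _ /=.
  under [RHS]eq_bigr do rewrite mulr_sumr.
  rewrite [RHS]exchange_big; apply: eq_bigr => s _ /=.
  under [RHS]eq_bigr do rewrite mulr_sumr.
  rewrite [RHS]exchange_big; apply: eq_bigr => rK _ /=.
  rewrite /h big_mkcond BE -mulmxA observe_packets //; apply: eq_bigr => Z _.
  by case: (_ != _); rewrite ?mulr1 ?mulr0.
apply: (@le_trans _ _ (#|msgt|%:R^-1 * (#|coin|%:R^-1 *
   \sum_(V : {ffun slot -> 'cV[L]_ZI}) eta * #|{: msgt * coins2}|%:R))).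
  rewrite ler_wpM2l ?invr_ge0 ?ler0n // ler_wpM2l ?invr_ge0 ?ler0n //.
  apply: ler_sum => V _.
  set N := #|_|%:R; have -> : eta * N = \sum_Z calvin (E *m spread V) Z * (eta * N).
    by rewrite -mulr_suml pmf_sum1 mul1r.
  apply: ler_sum => Z _; have [->|nz] := eqVneq (calvin (E *m spread V) Z) 0.
    by rewrite !mul0r.
  by rewrite ler_wpM2l ?pmf_ge0 //; apply/bad/(jam _ _ nz).
rewrite sumr_const -[X in _ * (_ * X)]mulr_natl !card_prod !natrM.
have msg_gt0 : 0 < #|msgt|%:R :> Rt by rewrite ltr0n msgt_gt0.
have := coin_gt0; rewrite !card_prod !muln_gt0 => /and3P[V_gt0 r_gt0 K_gt0].
rewrite le_eqVlt; apply/orP; left; apply/eqP; field.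
by rewrite !pnatr_eq0 -!lt0n V_gt0 r_gt0 K_gt0 msgt_gt0.
Qed.

End Assembly.

(** * Bit representations and circuit size of the code *)

Section Complexity.

Variable Rt : realType.
Variable M : nat.
Hypothesis M_ge4 : (4 <= M)%N.
Hypothesis symb_le : (#|{: symb * symb}| <= M)%N.
Hypothesis l_le : (l <= M)%N.
Hypothesis C_le : (C.+1 <= M)%N.
Hypothesis slot_le : (#|{: slot}| <= M)%N.
Hypothesis coord_le : (#|{: 'I_C.+1 * symb + 'I_l * symb}| <= M)%N.
Hypothesis gens_le : (#|{: 'I_C.+1 * symb + 'I_C * 'I_m}| <= M)%N.
Hypothesis exp_le : (4 * 2 ^ C <= M)%N.

Lemma card_F : #|F| = (2 ^ m)%N.
Proof.
rewrite (bij_eq_card (Bijective fbK bfK)) card_ffun card_bool card_ord //.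
Qed.

Lemma card_L : #|L| = (2 ^ (C * m))%N.
Proof.
rewrite (bij_eq_card (Bijective bitsK unbitsK)) card_ffun card_bool card_prod !card_ord //.
Qed.

Notation coin_sym := (slot * 'I_ZI + ('I_C.+1 + sbit * ('I_C * 'I_C.+1)))%type.
Notation coin_bit := (coin_sym * symb)%type.

Definition coin_val (w : coin) (x : coin_sym) : L :=
  match x with
  | inl (j, i) => w.1 j i 0
  | inr (inl k) => w.2.1 0 k
  | inr (inr (x, (k, c))) => w.2.2 x k c
  end.

Definition coin_of (v : {ffun coin_bit -> bool}) : coin :=
  let val x := unbits [ffun b => v (x, b)] in
  ([ffun j => \col_i val (inl (j, i))],
   (\row_k val (inr (inl k)), [ffun x => \matrix_(k, c) val (inr (inr (x, (k, c))))])).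

Definition coin_bits (w : coin) : {ffun coin_bit -> bool} :=
  [ffun x => bits (coin_val w x.1) x.2].

Lemma coin_ofK : cancel coin_of coin_bits.
Proof.
move=> v; apply/ffunP => -[x b]; rewrite ffunE /=.
suffices -> : coin_val (coin_of v) x = unbits [ffun b => v (x, b)].
  by rewrite unbitsK ffunE.
by case: x => [[j i]|[k|[x [k c]]]]; rewrite /= ?ffunE mxE.
Qed.

Lemma coin_bitsK : cancel coin_bits coin_of.
Proof.
move=> w; have val_bits x : unbits [ffun b => coin_bits w (x, b)] = coin_val w x.
  by rewrite -[RHS]bitsK; congr unbits; apply/ffunP => b; rewrite !ffunE.
case: w val_bits => [w1 [w2 w3]] val_bits; congr (_, (_, _)).
- by apply/ffunP => j; apply/colP => i; rewrite ffunE mxE val_bits.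
- by apply/rowP => k; rewrite mxE val_bits.
- by apply/ffunP => x; apply/matrixP => k c; rewrite ffunE mxE val_bits.
Qed.

Definition toss (c : #|{: coin_bit}|.-tuple bool) : coin :=
  coin_of [ffun x => nth false c (index x (enum {: coin_bit}))].

(** Bijectivity makes fair tosses induce exactly the uniform law on [coin], as the dyadic encoder
    model demands. *)
Lemma toss_bij : bijective toss.
Proof.
have sz w : size [seq coin_bits w x | x <- enum {: coin_bit}] == #|{: coin_bit}|.
  by rewrite size_map -cardE.
exists (fun w => Tuple (sz w)) => [c|w].
  apply: val_inj; rewrite /= -[RHS](map_nth_index (size_tuple c)).
  by apply: eq_map => x; rewrite coin_ofK ffunE.
rewrite -[RHS]coin_bitsK; congr coin_of; apply/ffunP => x.
rewrite ffunE /= (nth_map x) ?nth_index ?index_mem ?mem_enum //.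
Qed.

Lemma fcode_size x : size [seq fb x i | i <- enum 'I_m] == up_log 2 #|F|.
Proof. by rewrite size_map size_enum_ord card_F up_expnK. Qed.
Definition fcode x : (up_log 2 #|F|).-tuple bool := Tuple (fcode_size x).

Notation msg_bit := ('I_R * 'I_l * symb)%type.

Lemma mcode_size (S : msgt) :
  size [seq bits (S x.1.1 x.1.2) x.2 | x <- enum {: msg_bit}] == up_log 2 #|msgt|.
Proof.
rewrite size_map -cardE card_mx card_L -expnM up_expnK //.
by rewrite !card_prod !card_ord mulnC.
Qed.
Definition mcode S : (up_log 2 #|msgt|).-tuple bool := Tuple (mcode_size S).

Lemma fcode_inj : injective fcode.
Proof.
move=> x y /(congr1 val)/= /eq_in_map eq_xy; apply: (can_inj fbK).
by apply/ffunP => i; apply: eq_xy; rewrite mem_enum.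
Qed.

Lemma mcode_inj : injective mcode.
Proof.
move=> S T /(congr1 val)/= /eq_in_map eq_ST; apply/matrixP => i a.
apply: (can_inj bitsK); apply/ffunP => b.
by apply: (eq_ST (i, a, b)); rewrite mem_enum.
Qed.

Definition mx_index : seq ('I_C * 'I_n * 'I_m) :=
  flatten [seq [seq (k, p, i) | i <- enum 'I_m] | k <- enum 'I_C, p <- enum 'I_n].

Lemma mem_mx_index kpi : kpi \in mx_index.
Proof.
case: kpi => [[k p] i]; apply/flattenP; exists [seq (k, p, i) | i <- enum 'I_m].
  by apply: allpairs_f; rewrite mem_enum.
by apply: map_f; rewrite mem_enum.
Qed.

Lemma mx_bitsE (X : 'M[F]_(C, n)) :
  mx_bits fcode X = [seq fb (X kpi.1.1 kpi.1.2) kpi.2 | kpi <- mx_index].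
Proof.
rewrite map_flatten map_allpairs /mx_bits; congr flatten.
apply: eq_allpairs => k p; by rewrite -map_comp.
Qed.

Lemma mx_bits_inj : injective (mx_bits (n := n) (C := C) fcode).
Proof.
move=> X Y; rewrite !mx_bitsE => /eq_in_map eq_XY; apply/matrixP => k p.
apply: (can_inj fbK); apply/ffunP => i; apply: (eq_XY (k, p, i)).
exact: mem_mx_index.
Qed.

Lemma encoder_circuit : exists2 cenc, (size (gates cenc) <= M ^ 13)%N &
  forall (S : msgt) (c : #|{: coin_bit}|.-tuple bool),
    run cenc (mcode S ++ c) = mx_bits fcode (packets S (toss c)).
Proof.
pose D := (msgt * #|{: coin_bit}|.-tuple bool)%type.
pose inp (d : D) := mcode d.1 ++ d.2.
pose n0 := (up_log 2 #|msgt| + #|{: coin_bit}|)%N.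
have size_inp d : size (inp d) = n0 by rewrite size_cat !size_tuple.
pose f (x : msg_bit + coin_bit) (d : D) := match x with
  | inl x => bits (d.1 x.1.1 x.1.2) x.2
  | inr x => nth false d.2 (index x (enum {: coin_bit}))
  end.
pose ks : seq (msg_bit + coin_bit) :=
  [seq inl x | x <- enum {: msg_bit}] ++ [seq inr x | x <- enum {: coin_bit}].
have inpE d : inp d = [seq f x d | x <- ks].
  rewrite map_cat; congr (_ ++ _); first by rewrite -map_comp.
  rewrite -map_comp; exact: esym (map_nth_index (size_tuple d.2)).
have base x : has_wire inp n0 [::] (f x).
  apply: input_wire inpE _.
    have e1 : size (enum {: msg_bit}) = up_log 2 #|msgt|.
      by rewrite -(eqP (mcode_size (0 : 'M_(R, l)))) size_map.
    have e2 : size (enum {: coin_bit}) = #|{: coin_bit}| by rewrite cardE.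
    by rewrite size_cat; apply: (f_equal2 addn); rewrite size_map ?e1 ?e2.
  rewrite mem_cat; case: x => x; apply/orP; [left | right];
    by apply: map_f; rewrite mem_enum.
have coinE x : known inp n0 [::] (fun d : D => coin_val (toss d.2) x).
  move=> b; apply: eq_has_wire (base (inr (x, b))) => d.
  by have /ffunP/(_ (x, b)) := coin_ofK [ffun y => nth false d.2 (index y (enum {: coin_bit}))];
     rewrite !ffunE.
have [gs [_ sz H]] : feasible M 13 [::] (fun gs' => forall kpi : 'I_C * 'I_n * 'I_m,
    has_wire inp n0 gs' (fun d : D => fb (packets d.1 (toss d.2) kpi.1.1 kpi.1.2) kpi.2)).
  apply: wires_packets => // [i a b|j i|k|x k c].
  - exact: base (inl (i, a, b)).
  - exact: coinE (inl (j, i)).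
  - exact: coinE (inr (inl k)).
  - exact: coinE (inr (inr (x, (k, c)))).
have [c [cgs runc]] := wires_circuit mx_index H; exists c; first by rewrite cgs.
by move=> S t; rewrite mx_bitsE -(runc (S, t)).
Qed.

Lemma decoder_circuit : exists2 cdec, (size (gates cdec) <= M ^ 15)%N &
  forall Y : 'M[F]_(C, n), run cdec (mx_bits fcode Y) = mcode (decode Y).
Proof.
pose inp (Y : 'M[F]_(C, n)) := mx_bits fcode Y.
pose f (kpi : 'I_C * 'I_n * 'I_m) (Y : 'M[F]_(C, n)) := fb (Y kpi.1.1 kpi.1.2) kpi.2.
have inpE Y : inp Y = [seq f x Y | x <- mx_index] by apply: mx_bitsE.
have size_inp Y : size (inp Y) = size mx_index by rewrite inpE size_map.
have base x : has_wire inp (size mx_index) [::] (f x).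
  by apply: input_wire inpE _ => //; apply: mem_mx_index.
have [gs [_ sz H]] : feasible M 15 [::] (fun gs' => forall iab : msg_bit,
    has_wire inp (size mx_index) gs'
      (fun Y => bits (decode Y iab.1.1 iab.1.2) iab.2)).
  by apply: wires_decode => // k p i; apply: base (k, p, i).
have [c [cgs runc]] := wires_circuit (enum {: msg_bit}) H.
by exists c; [rewrite cgs | exact: runc].
Qed.

Lemma code_complexity (T : Rt) :
  (M ^ 13 + #|{: coin_bit}| + M ^ 15)%:R <= T -> complexity_at_most (code Rt) T.
Proof.
move=> leT; have [cenc sz_enc run_enc] := encoder_circuit.
have [cdec sz_dec run_dec] := decoder_circuit.
exists fcode, mcode, #|{: coin_bit}|, cenc, cdec; split=> //.
- by split; [exact: fcode_inj | exact: mcode_inj].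
- move=> S X; rewrite /= /push_mass (_ : #|coin|%:R = 2 ^+ #|{: coin_bit}|); last first.
    by rewrite -(bij_eq_card toss_bij) card_tuple card_bool natrX.
  congr (_%:R / _); rewrite -(on_card_preimset (f := toss)); last first.
    by have [g tossK gK] := toss_bij; exists g => x _.
  by apply: eq_card => c; rewrite !inE run_enc (inj_eq mx_bits_inj).
- apply: le_trans leT; rewrite ler_nat leq_add // leq_add2r //.
Qed.

End Complexity.

End Scheme.

(** * The main theorem *)

(** With q the quotient of m by e, m <= (q + 1) e <= 2 e 2^q; then raise to the power e. *)
Lemma expn_le_exp2n e m : (0 < e <= m)%N -> (m ^ e <= (2 * e) ^ e * 2 ^ m)%N.
Proof.
case/andP=> e_gt0 le_em; pose q := (m %/ e)%N.
have q_gt0 : (0 < q)%N by rewrite divn_gt0.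
apply: (@leq_trans ((2 * e) ^ e * (2 ^ q) ^ e)); last first.
  by rewrite leq_mul2l -expnM leq_exp2l ?leq_trunc_div ?orbT.
rewrite -expnMn leq_exp2r //.
apply: (@leq_trans (q.+1 * e)); first exact/ltnW/ltn_ceil.
rewrite mulnAC leq_mul2r; apply/orP; right.
by apply: ltn_trans (ltn_expl q (ltnSn 1)) _; rewrite ltn_Pmull ?expn_gt0.
Qed.

(** The preceding bound at exponent e + 1 leaves a spare factor m, which eventually exceeds any
    constant. *)
Lemma exp2n_dominates (Rt : realType) (c eps : Rt) e : 0 < eps -> 0 <= c ->
  exists m0, forall m, (m0 <= m)%N -> c * (m ^ e)%:R < eps * (2 ^ m)%:R.
Proof.
move=> eps_gt0 c_ge0; pose d := ((2 * e.+1) ^ e.+1)%N.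
exists (maxn e.+1 (Num.bound (c * d%:R / eps)).+1) => m; rewrite geq_max => /andP[le_em lt_bm].
have m_gt0 : 0 < m%:R :> Rt by rewrite ltr0n (leq_trans _ le_em).
have le1 : m%:R * (m ^ e)%:R <= d%:R * (2 ^ m)%:R :> Rt.
  by rewrite -!natrM ler_nat -expnS expn_le_exp2n.
have lt2 : c * d%:R / eps < m%:R.
  apply: lt_le_trans (archi_boundP _) _.
    by rewrite divr_ge0 ?mulr_ge0 ?ler0n // ltW.
  by rewrite ler_nat ltnW.
rewrite ltr_pdivrMr // in lt2.
have p_gt0 : 0 < (2 ^ m)%:R :> Rt by rewrite ltr0n expn_gt0.
rewrite -(ltr_pM2l m_gt0) mulrCA.
apply: le_lt_trans (ler_wpM2l c_ge0 le1) _; rewrite !mulrA.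
by rewrite ltr_pM2r.
Qed.

Lemma archi_le (Rt : realType) (a : nat) (delta : Rt) : 0 < delta ->
  exists N, forall n, (N <= n)%N -> a%:R <= delta * n%:R.
Proof.
move=> delta_gt0; exists (Num.bound (a%:R / delta)) => n le_n.
rewrite mulrC -ler_pdivrMr //; apply/ltW/(lt_le_trans (archi_boundP _)).
  by rewrite divr_ge0 // ltW.
by rewrite ler_nat.
Qed.

Lemma achievability (Rt : realType) (C ZO ZI : nat) : (ZO + ZI < C)%N ->
  achievable_with ZO ZI
    (fun (F : finFieldType) (n : nat) (sch : scheme Rt F C n) =>
       complexity_at_most sch
         (n%:R * (('X^90)%:P : {poly {poly Rt}}).[(C%:R)%:P].[logb 2%:R #|F|%:R]))
    (C%:R - ZO%:R - ZI%:R).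
Proof.
move=> lt_C eps delta eps_gt0 delta_gt0.
have [R CE R_gt0] : exists2 R, (ZI + R + ZO = C)%N & (0 < R)%N.
  exists (C - (ZO + ZI))%N; last by rewrite subn_gt0.
  by rewrite addnAC [(ZI + ZO)%N]addnC subnKC // ltnW.
have ->: C%:R - ZO%:R - ZI%:R = R%:R :> Rt by rewrite -CE !natrD; ring.
have C_gt0 : (0 < C)%N by apply: leq_ltn_trans lt_C.
have ZI_le : (ZI <= C)%N by rewrite -CE -addnA leq_addr.
have R_le : (R <= C)%N by rewrite -CE addnAC leq_addl.
pose kap := (R.+1 * C.+1 * C * C.+1 * C)%N.
have delta2_gt0 : 0 < delta / 2 by rewrite divr_gt0.
have [N1 N1P] := archi_le (R * kap) delta2_gt0.
have [N2 N2P] := archi_le (R * C) delta2_gt0.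
(* The key then costs at most R kap / K <= delta / 2 in rate; the other half of delta, through [N2],
   pays for rounding n to a multiple of C. *)
pose K := (kap + N1 + 1)%N.
have K_gt0 : (0 < K)%N by rewrite /K addn1.
have kap_K : (kap <= K)%N by rewrite /K -addnA leq_addr.
have K_delta := N1P K (leq_trans (leq_addl kap N1) (leq_addr 1 _)).
(* The numerator of the error bound is at most 2 n^(C+2), and n < 2 K m. *)
have c_ge0 : 0 <= 2 * ((2 * K) ^ C.+2)%:R :> Rt by rewrite mulr_ge0 ?ler0n.
have [m0 m0P] := exp2n_dominates C.+2 eps_gt0 c_ge0.
exists (maxn (K * (m0 + 2 * K).+1) (maxn (4 * 2 ^ C) (maxn N2 (maxn C.+1 3)))) => n.
rewrite !geq_max => /and5P[n_K n_exp n_N2 n_C n_ge3].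
have [] := code_parameters (R := R) (m0 := m0) C_gt0 K_gt0 kap_K n_K.
set m := (n %/ K)%N; set s := (R.+1 * C.+1 * (C * m))%N.
set l := (n %/ C - s * C.+1)%N; rewrite -/kap.
move=> [m_ge m_gt0 n_lt n_m2] mK slots n_l.
have kapm : (kap * m <= n)%N by apply: leq_trans mK; rewrite mulnC leq_mul2l kap_K orbT.
have [[M_ge4 M_symb M_l M_C] [M_slot M_coord M_gens M_exp] s_le l_le M_coin] :=
  complexity_parameters (R := R) (l := l) (m := m) C_gt0 ZI_le n_ge3 n_C n_exp kapm slots.
rewrite -/s in M_slot M_coin s_le; clearbody l.
have [F [L [iota [theta [crd [card_Fm crdK combK]]]]]] := field_tower m_gt0 C_gt0.
have [fb fbD [bf fbK bfK]] := finField_bits card_Fm.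
pose symb := ('I_C * 'I_m)%type.
pose sbit := ('I_R.+1 * 'I_C.+1 * symb)%type.
pose slot := ('I_l + sbit * 'I_C.+1)%type.
have card_symb : #|{: symb}| = (C * m)%N by rewrite card_prod !card_ord.
have card_sbit : #|{: sbit}| = s by rewrite !card_prod !card_ord.
have card_slot : #|{: slot}| = (l + s * C.+1)%N.
  by rewrite card_sum [X in (_ + X)%N]card_prod card_sbit !card_ord.
have card_vec t : #|{: 'I_t * symb}| = (t * (C * m))%N.
  by rewrite [LHS]card_prod card_symb card_ord.
have card_mask : #|{: slot * 'I_ZI}| = ((l + s * C.+1) * ZI)%N.
  by rewrite [LHS]card_prod card_slot card_ord.
have card_keys : #|{: sbit * ('I_C * 'I_C.+1)}| = (s * (C * C.+1))%N.
  by rewrite [LHS]card_prod card_sbit card_prod !card_ord.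
have slotC_le : (#|{: slot * 'I_C}| <= n)%N.
  by rewrite [X in (X <= _)%N]card_prod card_slot card_ord.
pose pos (jb : slot * 'I_C) : 'I_n := widen_ord slotC_le (enum_rank jb).
have pos_inj : injective pos by move=> x y /(congr1 val)/= /val_inj/enum_rank_inj.
have cardL : #|L| = (2 ^ (C * m))%N := card_L crdK combK fbK bfK.
have n_gt0 : 0 < n%:R :> Rt by rewrite ltr0n (leq_trans _ n_ge3).
have ln2_gt0 : 0 < ln 2 :> Rt by rewrite ln_gt0 // ltr1n.
have m_gt0' : 0 < m%:R :> Rt by rewrite ltr0n.
have lnE a : ln (2 ^ a)%:R = a%:R * ln 2 :> Rt.
  by rewrite natrX lnXn ?ltr0n // -[LHS]mulr_natl.
exists F, (code iota theta crd fb bf ZI pos Rt); split.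
- exact: (code_secret crdK combK fb bf CE pos).
- rewrite /rate /logb /= card_mx cardL card_Fm -expnM !lnE ler_pdivlMr //.
  have -> : (C * m * (R * l))%:R * ln 2 / (m%:R * ln 2) = (R * (l * C))%:R :> Rt.
    by rewrite !natrM; field; rewrite !gt_eqF.
  have n_l' : n%:R <= (l * C)%:R + C%:R + (kap * m)%:R :> Rt by rewrite -!natrD ler_nat.
  have N2' := N2P n n_N2.
  have mK' : m%:R * K%:R <= n%:R :> Rt by rewrite -natrM ler_nat.
  have : (R * kap)%:R * m%:R <= delta / 2 * n%:R :> Rt.
    apply: le_trans (ler_wpM2r (ler0n _ m) K_delta) _.
    rewrite -(mulrA (delta / 2)); apply: ler_wpM2l; first exact: ltW.
    by rewrite [K%:R * _]mulrC.
  have Rn : R%:R * n%:R <= R%:R * ((l * C)%:R + C%:R + (kap * m)%:R) :> Rt.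
    by rewrite ler_wpM2l ?ler0n.
  move: N2' Rn; rewrite !natrM => h1 h2 h3; lra.
- move=> A B calvin A_unit jam.
  apply: le_lt_trans (code_error crdK combK fbD fbK bfK CE R_gt0 pos_inj B A_unit jam) _.
  rewrite cardL card_sbit ltr_pdivrMr ?ltr0n ?expn_gt0 //.
  apply: (@lt_le_trans _ _ (eps * (2 ^ m)%:R)); last first.
    apply: ler_wpM2l; first exact: ltW.
    by rewrite ler_nat leq_exp2l // leq_pmull.
  apply: le_lt_trans (m0P m m_ge); rewrite -mulrA -natrM -expnMn -natrM ler_nat.
  apply: (@leq_trans (2 * n ^ C.+2)); last by rewrite leq_mul2l leq_exp2r // ltnW.
  rewrite mul2n -addnn leq_add //; first by rewrite (leq_trans s_le) // -[X in (X <= _)%N]expn1 leq_pexp2l // (leq_trans _ n_ge3).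
  rewrite [X in (_ <= X)%N]expnS; apply: leq_mul; last by rewrite leq_exp2r.
  exact: leq_trans R_le (ltnW n_C).
- apply: (code_complexity crdK combK fbD fbK bfK CE pos_inj (M := (n ^ 3)%N)) => //.
  + by rewrite [X in (X <= _)%N]card_prod card_symb.
  + by rewrite card_slot.
  + by rewrite card_sum !card_vec.
  + by rewrite card_sum card_vec card_symb.
  + rewrite hornerC hornerXn /logb card_Fm lnE mulfK ?gt_eqF //.
    rewrite -natrX -natrM ler_nat; apply: circuit_size_bound => //.
    apply: leq_trans M_coin; rewrite [X in (X <= _)%N]card_prod card_symb leq_mul2r; apply/orP; right.
    by rewrite card_sum card_mask card_sum card_ord card_keys.
Qed.

Theorem theorem2 (R : realType) :
  exists P : {poly {poly R}},
  forall C ZO ZI : nat, (ZO + ZI < C)%N ->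
    (forall r : R, C%:R - ZO%:R - ZI%:R < r -> ~ achievable C ZO ZI r) /\
    achievable_with ZO ZI
      (fun (F : finFieldType) (n : nat) (sch : scheme R F C n) =>
         complexity_at_most sch
           (n%:R * P.[(C%:R)%:P].[logb 2%:R #|F|%:R]))
      (C%:R - ZO%:R - ZI%:R).
Proof.
(* The polynomial is constant in C: the least block length may depend on C, so factors such as 2^C
   are bounded by n and then by m^2, where m is the logarithm of the field size. *)
exists (('X^90)%:P) => C ZO ZI lt_C; split; last exact: achievability.
by move=> r; apply: converse.
Qed.
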